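(* Let $N,F,\mathcal{T},Q\in\mathbb{N}$, $\epsilon,\gamma,\eta>0$, and let $\mathbf{G}_f\in\mathbb{R}^{2Q^2\times N}$, $\mathbf{r}_f^{(t)}\in\mathbb{R}^{2Q^2}$ for $f\in\{1,\dots,F\}$, $t\in\{1,\dots,\mathcal{T}\}$. Let $\mathbf{K}=\exp(-\mathbf{C}/\epsilon)$, where $\mathbf{C}_{i_1,\dots,i_{\mathcal{T}}}=\sum_{t=1}^{\mathcal{T}-1}c(\theta_{i_t},\theta_{i_{t+1}})$ for a real-valued pairwise cost $c$ on grid points $\theta_1,\dots,\theta_N$. Consider the dual problem, in the variables $\boldsymbol{\lambda}_f^{(t)}\in\mathbb{R}^{2Q^2}$ and $\boldsymbol{\psi}_f^{(t)}\in\mathbb{R}^N$, $$ \begin{aligned} \min\quad & \sum_{f=1}^F\epsilon\,\langle\mathbf{U}_f,\mathbf{V}_f\odot\mathbf{K}\rangle+\sum_{t=1}^{\mathcal{T}}\sum_{f=1}^F\Big(\frac{1}{2\gamma}\|\boldsymbol{\lambda}_f^{(t)}\|_2^2-\langle\boldsymbol{\lambda}_f^{(t)},\mathbf{r}_f^{(t)}\rangle\Big)\\ \text{subject to}\quad & \big\|[\boldsymbol{\psi}_1^{(t)},\ldots,\boldsymbol{\psi}_F^{(t)}]\big\|_{1,\infty}\le\eta,\qquad t\in\{1,\dots,\mathcal{T}\}, \end{aligned} $$ where $\mathbf{U}_f=\mathbf{u}_f^{(1)}\otimes\cdots\otimes\mathbf{u}_f^{(\mathcal{T})}$ with $\mathbf{u}_f^{(t)}=\exp(\frac1\epsilon\mathbf{G}_f^T\boldsymbol{\lambda}_f^{(t)})$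 and $\mathbf{V}_f=\mathbf{v}_f^{(1)}\otimes\cdots\otimes\mathbf{v}_f^{(\mathcal{T})}$ with $\mathbf{v}_f^{(t)}=\exp(\frac1\epsilon\boldsymbol{\psi}_f^{(t)})$. Perform a block coordinate descent, i.e. optimize iteratively over one set of variables while keeping the other variables fixed, by iterating the following two steps (the vectors $\boldsymbol{\xi}_f^{(t)}$, defined in the context, being computed from the current variables before each step): 1. for $t\in\{1,\dots,\mathcal{T}\}$ and $f\in\{1,\dots,F\}$, let $$\boldsymbol{\lambda}_f^{(t)}\leftarrow\operatorname*{arg\,min}_{\boldsymbol{\lambda}}\ \epsilon\big\langle e^{\mathbf{G}_f^T\boldsymbol{\lambda}/\epsilon},\mathbf{v}_f^{(t)}\odot\boldsymbol{\xi}_f^{(t)}\big\rangle+\frac{1}{2\gamma}\|\boldsymbol{\lambda}\|_2^2-\langle\boldsymbol{\lambda},\mathbf{r}_f^{(t)}\rangle;$$ 2. for $t\in\{1,\dots,\mathcal{T}\}$, let $$\{\boldsymbol{\psi}_1^{(t)},\dots,\boldsymbol{\psi}_F^{(t)}\}\leftarrow\operatorname*{arg\,min}_{\boldsymbol{\psi}_1,\dots,\boldsymbol{\psi}_F}\ \sum_{f=1}^F\epsilon\big\langle e^{\boldsymbol{\psi}_f/\epsilon},\mathbf{u}_f^{(t)}\odot\boldsymbol{\xi}_f^{(t)}\big\rangle\quad\text{subject to }\big\|[\boldsymbol{\psi}_1,\ldots,\boldsymbol{\psi}_F]\big\|_{1,\infty}\le\eta.$$ Then the iterates converge linearly to the optimal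 solution of the dual problem. In the limit point, the optimal solution of the primal problem $$ \min_{\mathbf{M}_1,\dots,\mathbf{M}_F}\ \sum_{f=1}^F\big(\langle\mathbf{C},\mathbf{M}_f\rangle+\epsilon D(\mathbf{M}_f)\big)+\sum_{t=1}^{\mathcal{T}}\sum_{f=1}^F\frac{\gamma}{2}\big\|\mathbf{r}_f^{(t)}-\mathbf{G}_fP^{(t)}(\mathbf{M}_f)\big\|_2^2+\eta\sum_{t=1}^{\mathcal{T}}\big\|[P^{(t)}(\mathbf{M}_1),\ldots,P^{(t)}(\mathbf{M}_F)]\big\|_{\infty,1} $$ over nonnegative $\mathcal{T}$-mode tensors $\mathbf{M}_f\in\mathbb{R}_+^{N\times\cdots\times N}$ can be constructed as $\mathbf{M}_f=\mathbf{U}_f\odot\mathbf{K}\odot\mathbf{V}_f$, $f\in\{1,\dots,F\}$.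
   Context: $\odot$ is the entrywise product, $\otimes$ the tensor (outer) product, $\exp$ (also written $e^{(\cdot)}$) is entrywise, $\langle\cdot,\cdot\rangle$ is the entrywise inner product of vectors or tensors, and $\mathbf{1}\in\mathbb{R}^N$ is the all-ones vector. For an $N\times F$ matrix, $\|[\boldsymbol{\psi}_1,\ldots,\boldsymbol{\psi}_F]\|_{1,\infty}=\max_{1\le i\le N}\sum_{f=1}^F|(\boldsymbol{\psi}_f)_i|$ and $\|[\mathbf{p}_1,\ldots,\mathbf{p}_F]\|_{\infty,1}=\sum_{i=1}^N\max_{1\le f\le F}|(\mathbf{p}_f)_i|$. The projection $P^{(t)}(\mathbf{M})\in\mathbb{R}^N$ of a $\mathcal{T}$-mode tensor is obtained by summing over all indices except the $t$-th, and $D(\mathbf{M})=\sum_{i_1,\dots,i_{\mathcal{T}}=1}^N\big(\mathbf{M}_{i_1,\dots,i_{\mathcal{T}}}\log\mathbf{M}_{i_1,\dots,i_{\mathcal{T}}}-\mathbf{M}_{i_1,\dots,i_{\mathcal{T}}}+1\big)$. With the $N\times N$ matrix $K_{ij}=\exp(-c(\theta_i,\theta_j)/\epsilon)$, the vectors $\boldsymbol{\xi}_f^{(t)}=\mathbf{w}_f^{(t)}\odot\hat{\mathbf{w}}_f^{(t)}$ are computed from the current $\mathbf{u}$'s and $\mathbf{v}$'s by $\hat{\mathbf{w}}_f^{(1)}=\mathbf{1}$, $\hat{\mathbf{w}}_f^{(t)}=K^T(\mathbf{u}_f^{(t-1)}\odot\mathbf{v}_f^{(t-1)}\odot\hat{\mathbf{w}}_f^{(t-1)})$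 for $t>1$, and $\mathbf{w}_f^{(\mathcal{T})}=\mathbf{1}$, $\mathbf{w}_f^{(t)}=K(\mathbf{u}_f^{(t+1)}\odot\mathbf{v}_f^{(t+1)}\odot\mathbf{w}_f^{(t+1)})$ for $t<\mathcal{T}$. *)

(* Defs.v *)
From HB Require Import structures.
From mathcomp Require Import all_boot all_order all_algebra.
From mathcomp Require Import all_classical all_reals all_analysis.

Set Implicit Arguments.
Unset Strict Implicit.
Unset Printing Implicit Defensive.
Import Order.TTheory GRing.Theory Num.Theory.
Local Open Scope ring_scope.
Local Open Scope classical_set_scope.

(* Indices are 0-based throughout: t : 'I_T stands for the (t+1)-st mode. *)

Definition is_minimizer (R : realType) (X : Type) (A : set X) (f : X -> R)
  (x : X) : Prop := A x /\ forall y, A y -> f x <= f y.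

(* An arbitrary minimizer; 0 if there is none. *)
Definition argmin (R : realType) (X : zmodType) (A : set X) (f : X -> R) : X :=
  xget 0 (is_minimizer A f).

Definition dotv (R : realType) n (x y : 'cV[R]_n) : R := \sum_i x i 0 * y i 0.

Definition normsq (R : realType) n (x : 'cV[R]_n) : R := \sum_i x i 0 ^+ 2.

Definition hadv (R : realType) n (x y : 'cV[R]_n) : 'cV[R]_n := map2_mx *%R x y.

Definition expv (R : realType) n (x : 'cV[R]_n) : 'cV[R]_n := map_mx (@expR R) x.

Definition norm_1inf (R : realType) N F (A : 'M[R]_(N, F)) : R :=
  \big[Num.max/0]_(i < N) \sum_(f < F) `|A i f|.

Definition norm_inf1 (R : realType) N F (A : 'M[R]_(N, F)) : R :=
  \sum_(i < N) \big[Num.max/0]_(f < F) `|A i f|.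

(* T-mode tensors of size N x ... x N; a multi-index is i : {ffun 'I_T -> 'I_N}. *)
Definition tensor (R : realType) N T : Type := {ffun {ffun 'I_T -> 'I_N} -> R}.

Section Tensors.
Context {R : realType} {N T : nat}.
Implicit Types X Y M : tensor R N T.

Definition dott X Y : R := \sum_i X i * Y i.

Definition hadt X Y : tensor R N T := [ffun i => X i * Y i].

Definition outer (x : 'I_T -> 'cV[R]_N) : tensor R N T :=
  [ffun i : {ffun 'I_T -> 'I_N} => \prod_(t < T) x t (i t) 0].

Definition proj (t : 'I_T) M : 'cV[R]_N :=
  \col_j \sum_(i : {ffun 'I_T -> 'I_N} | i t == j) M i.

(* [ln 0 = 0] in the library, so the summand is 1 at a zero entry. *)
Definition entropy M : R := \sum_i (M i * ln (M i) - M i + 1).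

End Tensors.

Section Costs.
Context {R : realType} {N : nat} {Theta : Type}.
Variables (theta : 'I_N -> Theta) (c : Theta -> Theta -> R).

Definition cost_tensor T : tensor R N T :=
  [ffun i : {ffun 'I_T -> 'I_N} =>
     \sum_(p : 'I_T * 'I_T | val p.2 == (val p.1).+1)
        c (theta (i p.1)) (theta (i p.2))].

Definition kernel_tensor (eps : R) T : tensor R N T :=
  [ffun i => expR (- cost_tensor T i / eps)].

Definition kernel_mx (eps : R) : 'M[R]_N :=
  \matrix_(i, j) expR (- c (theta i) (theta j) / eps).

End Costs.

(* The vectors w-hat^(t), w^(t) and xi^(t), where [a t] is the product of
   u^(t) and v^(t). The recursions over t are written as folds over the modes
   before (resp. after) t; [what_first] to [wvec_prev] give them in the usual
   form. *)
Section Scaling.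
Context {R : realType} {N T : nat}.
Variables (K : 'M[R]_N) (a : 'I_T -> 'cV[R]_N).

Definition what (t : 'I_T) : 'cV[R]_N :=
  foldl (fun h s => K^T *m hadv (a s) h) (const_mx 1) (take t (enum 'I_T)).

Definition wvec (t : 'I_T) : 'cV[R]_N :=
  foldr (fun s h => K *m hadv (a s) h) (const_mx 1) (drop t.+1 (enum 'I_T)).

Definition xi (t : 'I_T) : 'cV[R]_N := hadv (wvec t) (what t).

Lemma what_first (t : 'I_T) : t = 0%N :> nat -> what t = const_mx 1.
Proof. by rewrite /what => ->; rewrite take0. Qed.

Lemma what_next (s t : 'I_T) : t = s.+1 :> nat ->
  what t = K^T *m hadv (a s) (what s).
Proof.
rewrite /what => ->.
by rewrite (take_nth s) ?size_enum_ord// nth_ord_enum foldl_rcons.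
Qed.

Lemma wvec_last (t : 'I_T) : t.+1 = T -> wvec t = const_mx 1.
Proof. by move=> tT; rewrite /wvec drop_oversize// size_enum_ord tT. Qed.

Lemma wvec_prev (s t : 'I_T) : t = s.+1 :> nat ->
  wvec s = K *m hadv (a t) (wvec t).
Proof.
rewrite /wvec => ts.
by rewrite -ts (drop_nth t) ?size_enum_ord// nth_ord_enum.
Qed.

End Scaling.

(* Column f of [psi x t] is the vector psi_f^(t). *)
Record dual_var (R : realType) (N F T d : nat) := DualVar {
  lam : 'I_F -> 'I_T -> 'cV[R]_d;
  psi : 'I_T -> 'M[R]_(N, F) }.

Section Problem.
Context {R : realType} {N F T d : nat} {Theta : Type}.
Variables (eps gamma eta : R).
Variables (G : 'I_F -> 'M[R]_(d, N)) (r : 'I_F -> 'I_T -> 'cV[R]_d).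
Variables (theta : 'I_N -> Theta) (c : Theta -> Theta -> R).
Implicit Types x y : dual_var R N F T d.

Definition uvec x (f : 'I_F) (t : 'I_T) : 'cV[R]_N :=
  expv (eps^-1 *: ((G f)^T *m lam x f t)).

Definition vvec x (f : 'I_F) (t : 'I_T) : 'cV[R]_N :=
  expv (eps^-1 *: col f (psi x t)).

Definition dual_objective x : R :=
  \sum_(f < F) eps * dott (outer (uvec x f))
                          (hadt (outer (vvec x f)) (kernel_tensor theta c eps T))
  + \sum_(t < T) \sum_(f < F)
      ((2 * gamma)^-1 * normsq (lam x f t) - dotv (lam x f t) (r f t)).

Definition dual_feasible : set (dual_var R N F T d) :=
  [set x | forall t, norm_1inf (psi x t) <= eta].

Definition xi_cur x (f : 'I_F) (t : 'I_T) : 'cV[R]_N :=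
  xi (kernel_mx theta c eps) (fun s => hadv (uvec x f s) (vvec x f s)) t.

(* Both argmins below are over strongly convex, resp. strictly convex on a
   compact set, problems, so they are attained at exactly one point. *)
Definition lam_argmin x (f : 'I_F) (t : 'I_T) : 'cV[R]_d :=
  argmin setT (fun l : 'cV[R]_d =>
    eps * dotv (expv (eps^-1 *: ((G f)^T *m l))) (hadv (vvec x f t) (xi_cur x f t))
    + (2 * gamma)^-1 * normsq l - dotv l (r f t)).

Definition psi_argmin x (t : 'I_T) : 'M[R]_(N, F) :=
  argmin [set P : 'M[R]_(N, F) | norm_1inf P <= eta] (fun P =>
    \sum_(f < F) eps * dotv (expv (eps^-1 *: col f P))
                            (hadv (uvec x f t) (xi_cur x f t))).

(* The vectors xi_f depend only on the variables with the same index f, so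
   updating lam_f^(t) for all f at once agrees with doing so one f at a time. *)
Definition lam_step x (t : 'I_T) : dual_var R N F T d :=
  DualVar (fun f s => if s == t then lam_argmin x f t else lam x f s) (psi x).

Definition psi_step x (t : 'I_T) : dual_var R N F T d :=
  DualVar (lam x) (fun s => if s == t then psi_argmin x t else psi x s).

(* The blocks are visited one after the other, in increasing order of t, and xi
   is recomputed from the current variables before each block update. *)
Definition bcd_iteration x : dual_var R N F T d :=
  foldl psi_step (foldl lam_step x (enum 'I_T)) (enum 'I_T).

Definition primal_objective (M : 'I_F -> tensor R N T) : R :=
  \sum_(f < F) (dott (cost_tensor theta c T) (M f) + eps * entropy (M f))
  + \sum_(t < T) \sum_(f < F)
      gamma / 2 * normsq (r f t - G f *m proj t (M f))
  + eta * \sum_(t < T) norm_inf1 (\matrix_(i < N, f < F) proj t (M f) i 0).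

Definition primal_feasible : set ('I_F -> tensor R N T) :=
  [set M | forall f i, 0 <= M f i].

Definition primal_of_dual x (f : 'I_F) : tensor R N T :=
  hadt (hadt (outer (uvec x f)) (kernel_tensor theta c eps T)) (outer (vvec x f)).

End Problem.

Definition dual_dist (R : realType) N F T d (x y : dual_var R N F T d) : R :=
  Num.sqrt (\sum_(t < T) \sum_(f < F)
    (normsq (lam x f t - lam y f t) + normsq (col f (psi x t) - col f (psi y t)))).

(* Linear convergence is meant in the root sense: the distance to the limit is
   dominated by a geometric sequence. *)
Definition converges_linearly (R : realType) N F T d
    (x : nat -> dual_var R N F T d) (xstar : dual_var R N F T d) : Prop :=
  exists C rho : R, 0 <= rho < 1 /\ forall k, dual_dist (x k) xstar <= C * rho ^+ k.

(* Main.v *)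
Require Import Defs.
From HB Require Import structures.
From mathcomp Require Import all_boot all_order all_algebra.
From mathcomp Require Import all_classical all_reals all_analysis.
From mathcomp Require Import ring lra.

Set Implicit Arguments.
Unset Strict Implicit.
Unset Printing Implicit Defensive.
Import Order.TTheory GRing.Theory Num.Theory.
Import numFieldNormedType.Exports.
Local Open Scope ring_scope.
Local Open Scope classical_set_scope.

(** The dual objective is a strongly convex function of the linear forms
    [sum_t (G_f^T lam_f^(t) + psi_f^(t))_(i_t) / eps] and of [lam], locally on
    bounded sets. It is not strictly convex in [psi]: constants can be moved
    between the modes. The minimizers hence form the polyhedron cut out of the
    feasible set by fixing these forms, and Hoffman's error bound for this
    polyhedron turns strong convexity in the forms into quadratic growth: the
    squared distance to the minimizers is at most a multiple of the gap
    [dual x - min]. Each block subproblem is strongly convex, so a block update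
    decreases the objective by a multiple of the squared step; adding up the
    variational inequalities of the blocks bounds the gap after a sweep by step
    length times distance to the minimizers. Together the gap after a sweep is
    at most a multiple of the decrease during the sweep, so the gap decays
    geometrically, the steps are summable, and the iterates converge to some
    minimizer at a geometric rate.

    For the primal problem, the duality gap splits exactly into a
    Kullback-Leibler divergence between [M_f] and [U_f K V_f], a squared
    residual, and a defect of the norm pairing. All are nonnegative, the last
    two vanish at a dual minimizer by first-order optimality, and the first
    vanishes only at [M_f = U_f K V_f]. *)

(** * Hoffman's error bound *)

Definition lin (R : realType) (J : finType) (a z : J -> R) : R :=
  \sum_j a j * z j.

(** * Elementary inequalities for the exponential *)

Section ExponentialBounds.
Context {R : realType}.
Implicit Types s t h M : R.

Lemma expR_lipschitz M s t : s <= M -> t <= M ->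
  `|expR s - expR t| <= expR M * `|s - t|.
Proof.
wlog le_ts : s t / t <= s => [th sM tM|sM tM].
  have [le_ts|/ltW le_st] := leP t s; first exact: th.
  by rewrite distrC (distrC s); exact: th.
rewrite !ger0_norm ?subr_ge0 ?ler_expR//.
have -> : expR t = expR s * expR (t - s) by rewrite -expRD addrC subrK.
have := expR_ge1Dx (t - s); set e := expR (t - s) => he.
apply: (@le_trans _ _ (expR s * (s - t))).
  by rewrite -[X in X - _]mulr1 -mulrBr ler_pM2l ?expR_gt0//; lra.
by rewrite ler_wpM2r ?subr_ge0// ler_expR.
Qed.

Lemma expR_tangent s t : expR t * (s - t) <= expR s - expR t.
Proof.
have -> : expR s = expR t * expR (s - t) by rewrite -expRD addrC subrK.
have := expR_ge1Dx (s - t); set e := expR (s - t) => he.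
by rewrite -[X in _ <= _ - X]mulr1 -mulrBr ler_pM2l ?expR_gt0//; lra.
Qed.

(** For [h >= -2], squaring [1 + h / 2 <= exp (h / 2)] gives the lower bound [h ^+ 2 / 4]. For
    [h < -2] the linear term wins: [h ^+ 2 / (4 * M) <= - h / 2 <= - 1 - h]. *)
Lemma expR_quadratic_ge M h : 1 <= M -> `|h| <= 2 * M ->
  h ^+ 2 / (4 * M) <= expR h - 1 - h.
Proof.
move=> M1 /ler_normlP[hM1 hM2].
rewrite ler_pdivrMr; last by lra.
have [hge|hlt] := leP (- 2) h.
  have e2 : 0 <= 1 + h / 2 by lra.
  have : (1 + h / 2) ^+ 2 <= expR h.
    rewrite {2}(_ : h = h / 2 *+ 2); last by rewrite mulr2n; field.
    by rewrite mulr2n expRD -expr2 ler_pXn2r ?nnegrE ?expR_ge0 ?expR_ge1Dx.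
  by set e := expR h => he; nra.
by have := expR_gt0 h; set e := expR h => he; nra.
Qed.

Lemma expR_strongly_convex M s t : 1 <= M -> `|s| <= M -> `|t| <= M ->
  expR (- M) / (4 * M) * (s - t) ^+ 2 <= expR s - expR t - expR t * (s - t).
Proof.
move=> M1 sM tM.
have hM : `|s - t| <= 2 * M by rewrite (le_trans (ler_normB _ _))//; lra.
have := expR_quadratic_ge M1 hM.
have -> : expR s = expR t * expR (s - t) by rewrite -expRD addrC subrK.
have tge : expR (- M) <= expR t by rewrite ler_expR lerNl; case/ler_normlP: tM.
set e := expR (s - t) => he.
rewrite (_ : _ * e - _ - _ = expR t * (e - 1 - (s - t))); last by ring.
rewrite (_ : _ * _ ^+ 2 = expR (- M) * ((s - t) ^+ 2 / (4 * M))); last by ring.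
apply: ler_pM => //; rewrite ?expR_ge0//.
by apply: divr_ge0; [exact: sqr_ge0|lra].
Qed.

End ExponentialBounds.

(** * Lipschitz dependence of polyhedra on their right-hand sides *)

Section Hoffman.
Context {R : realType}.

(** Cut [x] down to the least upper end, then raise the result to the greatest lower end. The raise
    keeps the upper bounds because every [l q] is below every [u p]. This chooses the eliminated
    coordinate in Fourier-Motzkin elimination. *)
Lemma clamp_between (I : finType) (P Q : pred I) (u l : I -> R) (x e : R) :
  0 <= e ->
  (forall p, P p -> x <= u p + e) -> (forall q, Q q -> l q <= x + e) ->
  (forall p q, P p -> Q q -> l q <= u p) ->
  exists y, [/\ forall p, P p -> y <= u p, forall q, Q q -> l q <= y
    & `|x - y| <= e].
Proof.
move=> e0 xu lx lu.
(* Starting the minimum at [x] makes [v <= x] hold even without upper bounds. *)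
pose v := \big[Num.min/x]_(p | P p) u p.
have vx : v <= x by rewrite /v; elim/big_rec: _ => // i y _; rewrite ge_min orbC => ->.
have vu p : P p -> v <= u p by move=> Pp; rewrite /v; exact: bigmin_le_cond.
have xv : x - e <= v.
  rewrite /v; elim/big_ind: _ => [|a b ha hb|p /xu]; [lra| |lra].
  by rewrite le_min ha.
exists (\big[Num.max/v]_(q | Q q) l q); split=> [p Pp|q Qq|].
- elim/big_ind: _ => [|a b ha hb|q Qq]; [exact: vu| |exact: lu].
  by rewrite ge_max ha.
- exact: le_bigmax_cond.
- set y := \big[_/_]_(_ | _) _.
  have vy : v <= y.
    by rewrite /y; elim/big_rec: _ => // i z _; rewrite le_max orbC => ->.
  have yx : y <= x + e.
    rewrite /y; elim/big_ind: _ => [|a b ha hb|q Qq]; [lra| |exact: lx].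
    by rewrite ge_max ha.
  by apply/ler_normlP; split; lra.
Qed.

Lemma sumr_bound (I : finType) (F : I -> R) (B : R) :
  (forall i, `|F i| <= B) -> `|\sum_i F i| <= #|I|%:R * B.
Proof.
move=> FB; apply: (le_trans (ler_norm_sum _ _ _)).
by apply: (le_trans (ler_sum _ (fun i _ => FB i))); rewrite sumr_const mulr_natl.
Qed.

Lemma le_sum_nneg (I : finType) (F : I -> R) i :
  (forall i, 0 <= F i) -> F i <= \sum_i F i.
Proof. by move=> F0; rewrite (bigD1 i)//= lerDl sumr_ge0. Qed.

(* Fourier-Motzkin elimination of the first variable: the fibres over the
   projected polyhedron are intervals with Lipschitz end points. *)
Lemma polyhedron_lipschitz_ord n (I : finType) (A : I -> 'I_n -> R) :
  exists2 kappa, 0 <= kappa & forall b b' x x0 delta,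
    0 <= delta ->
    (forall i, `|b i - b' i| <= delta) ->
    (forall i, lin (A i) x <= b i) -> (forall i, lin (A i) x0 <= b' i) ->
    exists2 y, forall i, lin (A i) y <= b' i
             & forall j, `|x j - y j| <= kappa * delta.
Proof.
elim: n I A => [|n IHn] I A.
  exists 0 => // b b' x x0 delta _ _ _ hx0; exists x0 => // -[] //.
pose al i := A i ord0; pose tl (z : 'I_n.+1 -> R) j := z (lift ord0 j).
have linE (a z : 'I_n.+1 -> R) : lin a z = a ord0 * z ord0 + lin (tl a) (tl z).
  by rewrite /lin big_ord_recl.
(* The projected system is indexed by all of [I + I * I]: rows free of the first variable, and pairs
   with coefficients of opposite sign. The indicators turn every other index into the trivial row
   [0 <= 0]. *)
pose g p q : R := ((0 < al p) && (al q < 0))%:R.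
pose A' (k : I + I * I) j := match k with
  | inl i => (al i == 0)%:R * tl (A i) j
  | inr (p, q) => g p q * (tl (A p) j / al p - tl (A q) j / al q) end.
pose rhs (b : I -> R) k := match k with
  | inl i => (al i == 0)%:R * b i
  | inr (p, q) => g p q * (b p / al p - b q / al q) end.
have linA' k y : lin (A' k) y = rhs (fun i => lin (tl (A i)) y) k.
  case: k => [i|[p q]] /=; rewrite /lin /=.
    by rewrite mulr_sumr; apply: eq_bigr => j _; rewrite mulrA.
  rewrite !mulr_suml -sumrB mulr_sumr; apply: eq_bigr => j _; ring.
have proj_feas b z : (forall i, lin (A i) z <= b i) ->
    forall k, lin (A' k) (tl z) <= rhs b k.
  move=> hz k; rewrite linA'; case: k => [i|[p q]] /=.
    case: eqP => [ai|_]; last by rewrite !mul0r.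
    by have := hz i; rewrite linE -/(al i) ai mul0r add0r !mul1r.
  rewrite /g; case: andP => [[ap aq]|_]; last by rewrite !mul0r.
  have := hz p; have := hz q; rewrite !linE -/(al p) -/(al q).
  set sq := lin _ _; set sp := lin _ _ => hq hp; rewrite !mul1r.
  have hp' : z ord0 <= (b p - sp) / al p by rewrite ler_pdivlMr//; lra.
  have hq' : (b q - sq) / al q <= z ord0 by rewrite ler_ndivrMr//; lra.
  by move: (le_trans hq' hp'); rewrite !mulrBl; lra.
have [kap kap0 IH] := IHn _ A'.
pose mu := \sum_i `|(al i)^-1|.
pose aa := \sum_i \sum_j `|A i j|.
have mu0 : 0 <= mu by apply: sumr_ge0.
have aa0 : 0 <= aa by apply: sumr_ge0 => i _; apply: sumr_ge0.
have muE i : `|(al i)^-1| <= mu.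
  by apply: (@le_sum_nneg _ (fun i => `|(al i)^-1|)).
have aaE i j : `|A i j| <= aa.
  apply: (@le_trans _ _ (\sum_j `|A i j|)).
    exact: (@le_sum_nneg _ (fun j => `|A i j|)).
  by apply: (@le_sum_nneg _ (fun i => \sum_j `|A i j|)) => k; apply: sumr_ge0.
(* The projected right-hand sides move by at most [(1 + 2 * mu) * delta], hence the tail by
   [kap1 * delta]. The interval ends [bnd] for the first coordinate then move by at most
   [kap2 * delta]. *)
pose kap1 := kap * (1 + 2 * mu).
have kap10 : 0 <= kap1 by rewrite mulr_ge0//; lra.
pose kap2 := mu * (1 + n%:R * (aa * kap1)).
have kap20 : 0 <= kap2 by apply/mulr_ge0/addr_ge0/mulr_ge0/mulr_ge0.
exists (kap1 + kap2); first exact: addr_ge0.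
move=> b b' x x0 delta d0 hb hx hx0.
have [|k|y' hy' yy'] := IH (rhs b) (rhs b') (tl x) (tl x0) ((1 + 2 * mu) * delta)
    _ _ (proj_feas _ _ hx) (proj_feas _ _ hx0).
- by apply: mulr_ge0 => //; lra.
- case: k => [i|[p q]] /=; rewrite -mulrBr normrM ger0_norm ?ler0n//.
    case: eqP => _; last by rewrite mul0r mulr_ge0//; lra.
    by rewrite mul1r (le_trans (hb i))//; nra.
  apply: (@le_trans _ _ (2 * mu * delta)); last by nra.
  have hh : `|b p / al p - b q / al q - (b' p / al p - b' q / al q)|
      <= 2 * mu * delta.
    rewrite (_ : _ - _ = (b p - b' p) * (al p)^-1 - (b q - b' q) * (al q)^-1);
      last by ring.
    rewrite (le_trans (ler_normB _ _))// !normrM -mulrA mulr_natl mulr2n.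
    by rewrite (mulrC mu) lerD// ler_pM.
  by rewrite /g; case: (_ && _); rewrite ?mul1r// mul0r (le_trans _ hh).
pose bnd i := (b' i - lin (tl (A i)) y') / al i.
have bndE i : `|(b i - lin (tl (A i)) (tl x)) / al i - bnd i| <= kap2 * delta.
  rewrite -mulrBl normrM [leLHS]mulrC /kap2 -[leRHS]mulrA.
  apply: ler_pM; rewrite ?muE//.
  rewrite (_ : _ - _ = (b i - b' i) - (lin (tl (A i)) (tl x) - lin (tl (A i)) y'));
    last by ring.
  rewrite (le_trans (ler_normB _ _))// mulrDl mul1r lerD// /lin -sumrB -mulrA.
  rewrite -[n in leRHS]card_ord; apply: sumr_bound => j.
  by rewrite -mulrBr normrM -mulrA ler_pM// ?aaE// (le_trans (yy' j))// /kap1 mulrA.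
have [||p q ap aq|z0 [zu zl xz0]] := @clamp_between _ (fun p => 0 < al p)
    (fun q => al q < 0) bnd bnd (x ord0) (kap2 * delta) (mulr_ge0 kap20 d0).
- move=> p ap; have /ler_normlP[_ hp] := bndE p.
  have : x ord0 <= (b p - lin (tl (A p)) (tl x)) / al p.
    by rewrite ler_pdivlMr//; have := hx p; rewrite linE -/(al p); lra.
  by move: hp; lra.
- move=> q aq; have /ler_normlP[hq _] := bndE q.
  have : (b q - lin (tl (A q)) (tl x)) / al q <= x ord0.
    by rewrite ler_ndivrMr//; have := hx q; rewrite linE -/(al q); lra.
  by move: hq; lra.
(* The row [(p, q)] of the projected system says exactly that the lower end from [q] is below the
   upper end from [p]. *)
- have := hy' (inr (p, q)); rewrite linA' /= /g ap aq !mul1r /bnd.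
  by rewrite !mulrBl; lra.
pose y j := oapp y' z0 (unlift ord0 j); exists y.
  move=> i; rewrite linE -/(al i) {1}/y unlift_none /= (_ : tl y = y'); last first.
    by apply/funext => j; rewrite /tl /y liftK.
  have [ai|ai|ai] := ltrgtP (al i) 0.
  - by have := zl i ai; rewrite /bnd ler_ndivrMr//; lra.
  - by have := zu i ai; rewrite /bnd ler_pdivlMr//; lra.
  - by have := hy' (inl i); rewrite linA' /= ai eqxx !mul1r mul0r add0r.
move=> j; rewrite /y; case: (unliftP ord0 j) => [k|] -> /=.
  by rewrite ?liftK (le_trans (yy' k))// mulrA -/kap1 ler_wpM2r// lerDl.
by rewrite (le_trans xz0)// ler_wpM2r// lerDr.
Qed.

Lemma polyhedron_lipschitz (I J : finType) (A : I -> J -> R) :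
  exists2 kappa, 0 <= kappa & forall b b' x x0 delta, 0 <= delta ->
    (forall i, `|b i - b' i| <= delta) ->
    (forall i, lin (A i) x <= b i) -> (forall i, lin (A i) x0 <= b' i) ->
    exists2 y, forall i, lin (A i) y <= b' i
             & forall j, `|x j - y j| <= kappa * delta.
Proof.
have linE (a z : J -> R) : lin a z = lin (a \o @enum_val _ J) (z \o @enum_val _ J).
  by rewrite /lin (reindex (@enum_val _ J))//; exact/onW_bij/enum_val_bij.
have [kap kap0 H] := polyhedron_lipschitz_ord (fun i => A i \o @enum_val _ J).
exists kap => // b b' x x0 delta d0 hb hx hx0.
have [i|i|y hy xy] := H b b' (x \o @enum_val _ J) (x0 \o @enum_val _ J) _ d0 hb.
- by rewrite -linE.
- by rewrite -linE.
exists (y \o enum_rank) => [i|j].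
  rewrite linE (_ : (y \o enum_rank) \o @enum_val _ J = y)//.
  by apply/funext => k /=; rewrite enum_valK.
by have := xy (enum_rank j); rewrite /= enum_rankK.
Qed.

End Hoffman.

(** * Exponential sums with a separable quadratic *)

Section GeometricSequences.
Context {R : realType}.

(** Limits are taken through this lemma, both in difference quotients and along the iterates. *)
Lemma le_geometric_perturbation (x y C rho : R) : 0 <= rho < 1 ->
  (forall k, x <= y + C * rho ^+ k) -> x <= y.
Proof.
move=> /andP[r0 r1] H; rewrite leNgt; apply/negP => yx.
have r1' : `|rho| < 1 by rewrite ger0_norm.
have d0 : 0 < x - y by rewrite subr_gt0.
have /cvgr0_norm_lt/(_ _ d0) [n _ Hn] := @cvg_geometric R C rho r1'.
have := Hn n (leqnn n); rewrite /= => /(le_lt_trans (ler_norm _)).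
by have := H n; lra.
Qed.

(** With [B = A / (1 - rho)], that is [B - B * rho = A], the intervals of radius [B * rho ^+ k]
    around [u k] are nested. The limit is the supremum of their left ends. *)
Lemma geometric_cauchy (u : nat -> R) (A rho : R) : 0 <= rho < 1 ->
  (forall k, `|u k - u k.+1| <= A * rho ^+ k) ->
  exists l, forall k, `|u k - l| <= A / (1 - rho) * rho ^+ k.
Proof.
move=> /andP[r0 r1] hu; pose B := A / (1 - rho).
have BE : B - B * rho = A by rewrite /B; field; lra.
pose lo k := u k - B * rho ^+ k; pose hi k := u k + B * rho ^+ k.
have B0 : 0 <= B.
  apply: divr_ge0; last by lra.
  by have := le_trans (normr_ge0 _) (hu 0%N); rewrite expr0 mulr1.
have step k : lo k <= lo k.+1 /\ hi k.+1 <= hi k.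
  have /ler_normlP[h1 h2] := hu k.
  have := congr1 (fun y => y * rho ^+ k) BE; rewrite /lo /hi exprS => /= E.
  by split; lra.
have lohi k l : lo k <= hi l.
  have self n : lo n <= hi n.
    by rewrite /lo /hi; have := mulr_ge0 B0 (exprn_ge0 n r0); lra.
  have loI : {homo lo : i j / (i <= j)%N >-> i <= j}.
    by apply: homo_leq => // [y x z|i]; [exact: le_trans|exact: (step i).1].
  have hiD i j : (i <= j)%N -> hi j <= hi i.
    elim: j => [|j IH]; first by rewrite leqn0 => /eqP ->.
    rewrite leq_eqVlt => /orP[/eqP -> //|]; rewrite ltnS => /IH.
    exact/le_trans/(step j).2.
  apply: (le_trans (loI _ _ (leq_maxl k l))).
  exact: (le_trans (self _) (hiD _ _ (leq_maxr k l))).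
have hub l : ubound (range lo) (hi l) by move=> _ [k _ <-].
exists (sup (range lo)) => k.
have lok : lo k <= sup (range lo).
  by apply: ub_le_sup; [exists (hi 0%N); exact: hub|exists k].
have hik : sup (range lo) <= hi k.
  by apply: ge_sup; [exists (lo 0%N); exists 0%N|exact: hub].
by apply/ler_normlP; rewrite -/B; move: lok hik; rewrite /lo /hi => lok hik; split; lra.
Qed.

End GeometricSequences.

Section PolyhedronEqualities.
Context {R : realType}.

(** Each form in [E] enters as two opposite inequalities whose right-hand sides are its value at
    [x], respectively at [x0]. Passing from one system to the other moves the right-hand sides by at
    most [delta]. *)
Lemma polyhedron_error_bound (I L J : finType) (A : I -> J -> R)
    (E : L -> J -> R) :
  exists2 kappa, 0 <= kappa & forall beta x x0 delta, 0 <= delta ->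
    (forall i, lin (A i) x <= beta i) -> (forall i, lin (A i) x0 <= beta i) ->
    (forall l, `|lin (E l) x - lin (E l) x0| <= delta) ->
    exists y, [/\ forall i, lin (A i) y <= beta i,
                  forall l, lin (E l) y = lin (E l) x0
                & forall j, `|x j - y j| <= kappa * delta].
Proof.
pose A' (k : I + (L + L)) := match k with
  | inl i => A i | inr (inl l) => E l | inr (inr l) => fun j => - E l j end.
have linN (a z : J -> R) : lin (fun j => - a j) z = - lin a z.
  by rewrite /lin -sumrN; apply: eq_bigr => j _; rewrite mulNr.
have [kap kap0 H] := polyhedron_lipschitz A'.
exists kap => // beta x x0 delta d0 hx hx0 hE.
pose rhs z (k : I + (L + L)) := match k with
  | inl i => beta i | inr (inl l) => lin (E l) z
  | inr (inr l) => - lin (E l) z end.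
have [k|k|k|y hy xy] := H (rhs x) (rhs x0) x x0 delta d0.
- case: k => [i|[l|l]] /=; rewrite ?subrr ?normr0//.
  by rewrite -opprD normrN.
- by case: k => [i|[l|l]] //=; rewrite linN.
- by case: k => [i|[l|l]] //=; rewrite linN.
exists y; split=> // [i|l]; first exact: (hy (inl i)).
apply/eqP; rewrite eq_le (hy (inr (inl l))) /=.
by have := hy (inr (inr l)); rewrite /= linN lerN2.
Qed.

End PolyhedronEqualities.

(** * Convexity, gradient estimates and first-order optimality *)

Section ExpQuadratic.
Context {R : realType} {J K : finType}.
Variables (w : K -> R) (a : K -> J -> R) (q b : J -> R).
Implicit Types (y z h : J -> R) (C : set (J -> R)).

(** The shape of the dual objective in coordinates, with [q j = 0] on the [psi] coordinates. *)
Definition expquad z : R :=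
  \sum_k w k * expR (lin (a k) z) + \sum_j (q j / 2 * z j ^+ 2 - b j * z j).

Definition expquad_grad z (j : J) : R :=
  \sum_k w k * expR (lin (a k) z) * a k j + (q j * z j - b j).

Definition bregman z y : R :=
  expquad z - expquad y - lin (expquad_grad y) (fun j => z j - y j).

Lemma linB (c : J -> R) z y :
  lin c (fun j => z j - y j) = lin c z - lin c y.
Proof. by rewrite /lin -sumrB; apply: eq_bigr => j _; rewrite mulrBr. Qed.

Lemma bregmanE z y : bregman z y =
  \sum_k w k * (expR (lin (a k) z) - expR (lin (a k) y)
                - expR (lin (a k) y) * (lin (a k) z - lin (a k) y))
  + \sum_j q j / 2 * (z j - y j) ^+ 2.
Proof.
rewrite /bregman; have -> : lin (expquad_grad y) (fun j => z j - y j) =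
    \sum_k w k * expR (lin (a k) y) * (lin (a k) z - lin (a k) y)
    + \sum_j (q j * y j - b j) * (z j - y j).
  rewrite /lin; under eq_bigr do rewrite mulrDl.
  rewrite big_split /=; congr (_ + _).
  under eq_bigr do rewrite mulr_suml.
  rewrite exchange_big; apply: eq_bigr => k _ /=.
  rewrite -sumrB mulr_sumr; apply: eq_bigr => j _; ring.
rewrite /expquad opprD addrACA -!sumrB opprD addrACA -!sumrB.
congr (_ + _); apply: eq_bigr => i _; first by ring.
by field.
Qed.

Hypothesis w_gt0 : forall k, 0 < w k.
Hypothesis q_ge0 : forall j, 0 <= q j.

Lemma bregman_ge0 z y : 0 <= bregman z y.
Proof.
rewrite bregmanE addr_ge0// sumr_ge0// => i _; last first.
  by rewrite mulr_ge0 ?sqr_ge0 ?divr_ge0.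
by rewrite mulr_ge0 ?(ltW (w_gt0 _))// subr_ge0 expR_tangent.
Qed.

Lemma expquad_convex z y :
  lin (expquad_grad y) (fun j => z j - y j) <= expquad z - expquad y.
Proof. by rewrite -subr_ge0 bregman_ge0. Qed.

Lemma lin_bound B : exists2 M, 1 <= M &
  forall z k, (forall j, `|z j| <= B) -> `|lin (a k) z| <= M.
Proof.
exists (1 + \sum_k \sum_j `|a k j| * `|B|).
  by rewrite lerDl; apply: sumr_ge0 => k _; apply: sumr_ge0 => j _; apply: mulr_ge0.
move=> z k zB; apply: (le_trans (ler_norm_sum _ _ _)).
apply: (@le_trans _ _ (\sum_j `|a k j| * `|B|)).
  apply: ler_sum => j _; rewrite normrM ler_wpM2l//.
  exact: le_trans (zB j) (ler_norm _).
apply: ler_wpDl => //.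
apply: (@le_sum_nneg _ _ (fun k => \sum_j `|a k j| * `|B|)) => i.
by apply: sumr_ge0 => j _; apply: mulr_ge0.
Qed.

(** All summands in [bregmanE] are nonnegative, so each one alone is bounded by the divergence. On a
    bounded set the exponential summands dominate the squares of their forms. *)
Lemma bregman_strongly_convex B : exists2 kappa, 0 <= kappa &
  forall z y, (forall j, `|z j| <= B) -> (forall j, `|y j| <= B) ->
    (forall k, (lin (a k) z - lin (a k) y) ^+ 2 <= kappa * bregman z y) /\
    (forall j, 0 < q j -> (z j - y j) ^+ 2 <= kappa * bregman z y).
Proof.
have [M M1 HM] := lin_bound B.
pose s := expR (- M) / (4 * M).
have s0 : 0 < s by rewrite divr_gt0 ?expR_gt0//; lra.
pose kw := \sum_k (w k * s)^-1; pose kq := \sum_j (q j / 2)^-1.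
have kwi k : 0 <= (w k * s)^-1 by rewrite invr_ge0 mulr_ge0// ltW.
have kqi j : 0 <= (q j / 2)^-1 by rewrite invr_ge0 divr_ge0.
have kw0 : 0 <= kw by exact: sumr_ge0.
have kq0 : 0 <= kq by exact: sumr_ge0.
exists (kw + kq); first exact: addr_ge0.
move=> z y zB yB; have D0 := bregman_ge0 z y.
have T0 k : 0 <= w k * (expR (lin (a k) z) - expR (lin (a k) y)
                - expR (lin (a k) y) * (lin (a k) z - lin (a k) y)).
  by rewrite mulr_ge0 ?(ltW (w_gt0 _))// subr_ge0 expR_tangent.
have Q0 j : 0 <= q j / 2 * (z j - y j) ^+ 2.
  by rewrite mulr_ge0 ?sqr_ge0 ?divr_ge0.
split=> [k|j qj].
- apply: (@le_trans _ _ ((w k * s)^-1 * bregman z y)); last first.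
    rewrite ler_wpM2r// (le_trans (le_sum_nneg k kwi))// lerDl//.
  rewrite ler_pdivlMl; last exact: mulr_gt0.
  rewrite -mulrA.
  rewrite bregmanE ler_wpDr ?sumr_ge0//.
  apply: le_trans (le_sum_nneg k T0).
  rewrite ler_pM2l//; apply: expR_strongly_convex => //; exact: HM.
- apply: (@le_trans _ _ ((q j / 2)^-1 * bregman z y)); last first.
    rewrite ler_wpM2r// (le_trans (le_sum_nneg j kqi))// lerDr//.
  rewrite ler_pdivlMl ?divr_gt0//.
  rewrite bregmanE ler_wpDl ?sumr_ge0//.
  exact: le_sum_nneg j Q0.
Qed.

Lemma expquad_grad_lipschitz B : exists2 L, 0 <= L &
  forall z y m, (forall j, `|z j| <= B) -> (forall j, `|y j| <= B) ->
    (forall j, `|z j - y j| <= m) ->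
    forall j, `|expquad_grad z j - expquad_grad y j| <= L * m.
Proof.
have [M M1 HM] := lin_bound B.
pose ak k := \sum_j `|a k j|.
pose S := \sum_k w k * expR M * ak k * ak k.
have ak0 k : 0 <= ak k by exact: sumr_ge0.
have akE k j : `|a k j| <= ak k by apply: (@le_sum_nneg _ _ (fun j => `|a k j|)).
have S0 : 0 <= S.
  by apply: sumr_ge0 => k _; rewrite !mulr_ge0 ?expR_ge0// ltW.
exists (S + \sum_j q j); first by rewrite addr_ge0// sumr_ge0.
move=> z y m zB yB zy j; rewrite mulrDl.
rewrite /expquad_grad opprD addrACA -sumrB.
apply: (le_trans (ler_normD _ _)); apply: lerD; last first.
  rewrite (_ : _ - _ = q j * (z j - y j)); last by ring.
  rewrite normrM ger0_norm// ler_pM//; exact: le_sum_nneg.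
apply: (le_trans (ler_norm_sum _ _ _)); rewrite /S mulr_suml.
apply: ler_sum => k _.
rewrite -mulrBl -mulrBr !normrM (gtr0_norm (w_gt0 k)).
have lk : `|lin (a k) z - lin (a k) y| <= ak k * m.
  rewrite -linB (le_trans (ler_norm_sum _ _ _))// mulr_suml.
  by apply: ler_sum => i _; rewrite normrM ler_wpM2l.
have ek : `|expR (lin (a k) z) - expR (lin (a k) y)| <= expR M * (ak k * m).
  apply: (@le_trans _ _ (expR M * `|lin (a k) z - lin (a k) y|)).
    apply: expR_lipschitz; apply: (le_trans (ler_norm _)); exact: HM.
  by rewrite ler_wpM2l ?expR_ge0.
rewrite (_ : _ * m = w k * (expR M * (ak k * m)) * ak k); last by ring.
by rewrite ler_pM// ?mulr_ge0 ?(ltW (w_gt0 _))// ler_wpM2l// ltW.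
Qed.

Definition convex_subset C := forall z y (t : R), 0 <= t <= 1 -> C z -> C y ->
  C (fun j => y j + t * (z j - y j)).

(** By convexity and minimality of [y], the gradient at [y + t * h] is nonnegative on [h = z - y].
    The Lipschitz bound replaces it by the gradient at [y] at a cost proportional to [t], and [t]
    runs through the powers of one half. *)
Lemma expquad_variational C y z : convex_subset C ->
  is_minimizer C expquad y -> C z ->
  0 <= lin (expquad_grad y) (fun j => z j - y j).
Proof.
move=> cC [Cy ymin] Cz; pose h j := z j - y j.
pose m := \sum_j `|h j|; pose B := \sum_j (`|y j| + `|h j|).
have m0 : 0 <= m by exact: sumr_ge0.
have [L L0 HL] := expquad_grad_lipschitz B.
have BE j : `|y j| + `|h j| <= B.
  by apply: (@le_sum_nneg _ _ (fun j => `|y j| + `|h j|)) => i; exact: addr_ge0.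
have yB j : `|y j| <= B by rewrite (le_trans _ (BE j))// lerDl.
have tB t : 0 < t <= 1 -> 0 <= lin (expquad_grad y) h + t * (L * m * m).
  move=> /andP[t0 t1]; pose yt j := y j + t * h j.
  have ytB j : `|yt j| <= B.
    rewrite (le_trans (ler_normD _ _))// (le_trans _ (BE j))// lerD2l.
    by rewrite normrM gtr0_norm// ler_piMl.
  have d j : `|yt j - y j| <= t * m.
    rewrite /yt addrAC subrr add0r normrM gtr0_norm// ler_pM2l//.
    by apply: (@le_sum_nneg _ _ (fun j => `|h j|)).
  have yty : expquad y <= expquad yt by apply/ymin/cC => //; rewrite (ltW t0).
  have := expquad_convex y yt.
  rewrite (_ : lin _ _ = - t * lin (expquad_grad yt) h); last first.
    rewrite /lin mulr_sumr; apply: eq_bigr => j _; rewrite /yt; ring.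
  move=> hc; have g0 : 0 <= lin (expquad_grad yt) h.
    rewrite -(pmulr_rge0 _ t0); move: hc; rewrite mulNr; lra.
  apply: (le_trans g0); rewrite -lerBlDl -[leLHS](_ : lin (fun j =>
    expquad_grad yt j - expquad_grad y j) h = _); last first.
    by rewrite /lin -sumrB; apply: eq_bigr => j _; rewrite mulrBl.
  apply: (le_trans (ler_norm _)); apply: (le_trans (ler_norm_sum _ _ _)).
  rewrite [X in _ <= X](_ : _ = t * (L * m) * \sum_j `|h j|); last by rewrite -/m !mulrA.
  rewrite mulr_sumr; apply: ler_sum => j _.
  rewrite normrM ler_wpM2r// mulrCA; exact: HL.
apply: (@le_geometric_perturbation _ _ _ (L * m * m) (2^-1)).
  by apply/andP; split; lra.
move=> k; rewrite mulrC; apply: tB; rewrite exprn_gt0 ?invr_gt0//=.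
by rewrite exprn_ile1 ?invr_ge0// invf_le1// ler1n.
Qed.

End ExpQuadratic.

(** * Linear convergence of block coordinate descent *)

Section BlockCoordinateDescent.
Context {R : realType} {J K I : finType} {m : nat}.
Variables (w : K -> R) (a : K -> J -> R) (q b : J -> R).
Variables (c : I -> J -> R) (beta : I -> R) (blk : J -> 'I_m).
Implicit Types (x y z : J -> R).

Local Notation phi := (expquad w a q b).
Local Notation grad := (expquad_grad w a q b).

Definition polyhedron : set (J -> R) := [set z | forall i, lin (c i) z <= beta i].

Definition block_slice (s : 'I_m) y : set (J -> R) :=
  [set z | polyhedron z /\ forall j, blk j != s -> z j = y j].

(** Here [y s] is the point after the first [s] block updates. Any choice of block minimizers is
    allowed. *)
Definition bcd_cycle x x' := exists y : nat -> J -> R,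
  [/\ y 0%N = x, y m = x'
    & forall s : 'I_m, is_minimizer (block_slice s (y s)) phi (y s.+1)].

Lemma polyhedron_convex : convex_subset polyhedron.
Proof.
move=> z y t /andP[t0 t1] Pz Py i.
have -> : lin (c i) (fun j => y j + t * (z j - y j)) =
    (1 - t) * lin (c i) y + t * lin (c i) z.
  rewrite /lin !mulr_sumr -big_split /=; apply: eq_bigr => j _; ring.
have t1' : 0 <= 1 - t by lra.
have := lerD (ler_wpM2l t1' (Py i)) (ler_wpM2l t0 (Pz i)); lra.
Qed.

Lemma block_slice_convex s x : convex_subset (block_slice s x).
Proof.
move=> z y t t01 [Pz zx] [Py yx]; split=> [|j js]; first exact: polyhedron_convex.
by rewrite zx// yx// subrr mulr0 addr0.
Qed.

Hypothesis w_gt0 : forall k, 0 < w k.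
Hypothesis q_ge0 : forall j, 0 <= q j.
Hypothesis b_eq0 : forall j, q j = 0 -> b j = 0.
(** A coordinate either has its own quadratic term or is isolated within its block by one of the
    exponential forms. This makes each block subproblem strongly convex on bounded sets. *)
Hypothesis block_sep : forall j, 0 < q j \/
  exists2 k, a k j != 0 & forall j', blk j' = blk j -> j' != j -> a k j' = 0.
Hypothesis polyhedron_product : forall s z y, polyhedron z -> polyhedron y ->
  polyhedron (fun j => if blk j == s then z j else y j).

Lemma block_strongly_convex B : exists2 kappa, 0 <= kappa &
  forall s z y, (forall j, `|z j| <= B) -> (forall j, `|y j| <= B) ->
    (forall j, blk j != s -> z j = y j) ->
    forall j, (z j - y j) ^+ 2 <= kappa * bregman w a q b z y.
Proof.
have [kap kap0 H] := bregman_strongly_convex a b w_gt0 q_ge0 B.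
pose A := \sum_k \sum_j (a k j ^+ 2)^-1.
have Ai k j : 0 <= (a k j ^+ 2)^-1 by rewrite invr_ge0 sqr_ge0.
have A0 : 0 <= A by apply: sumr_ge0 => k _; exact: sumr_ge0.
have AE k j : (a k j ^+ 2)^-1 <= A.
  apply: (@le_trans _ _ (\sum_j (a k j ^+ 2)^-1)).
    exact: (@le_sum_nneg _ _ (fun j => (a k j ^+ 2)^-1)).
  by apply: (@le_sum_nneg _ _ (fun k => \sum_j (a k j ^+ 2)^-1)) => i; exact: sumr_ge0.
have kA0 := mulr_ge0 kap0 A0.
exists (kap + kap * A); first exact: addr_ge0.
move=> s z y zB yB zy j; have [Hk Hq] := H z y zB yB.
have D0 := bregman_ge0 a b w_gt0 q_ge0 z y.
have [js|/zy ->] := eqVneq (blk j) s; last first.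
  by rewrite subrr expr0n mulr_ge0// addr_ge0.
have [qj|[k akj ak]] := block_sep j.
  by rewrite (le_trans (Hq j qj))// ler_wpM2r// lerDl.
have E : lin (a k) z - lin (a k) y = a k j * (z j - y j).
  rewrite -linB /lin (bigD1 j)//= big1 ?addr0// => j' jj'.
  have [js'|/zy ->] := eqVneq (blk j') s; last by rewrite subrr mulr0.
  by rewrite ak ?mul0r// js' js.
apply: (@le_trans _ _ ((a k j ^+ 2)^-1 * (kap * bregman w a q b z y))).
  by rewrite ler_pdivlMl ?exprn_even_gt0//= -exprMn -E.
rewrite mulrA ler_wpM2r// mulrC; apply: ler_wpDl => //.
exact: ler_wpM2l.
Qed.

Section Convergence.
Variables (zs x0 : J -> R) (B : R).
Hypothesis zs_min : is_minimizer polyhedron phi zs.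
Hypothesis x0_poly : polyhedron x0.
Hypothesis sublevel_bounded : forall z, polyhedron z -> phi z <= phi x0 ->
  forall j, `|z j| <= B.

Let zs_poly : polyhedron zs := zs_min.1.
Let zs_le z : polyhedron z -> phi zs <= phi z.
Proof. exact: zs_min.2. Qed.
Let zs_bounded j : `|zs j| <= B.
Proof. by apply: sublevel_bounded => //; exact: zs_le. Qed.

(* The objective factors through the forms [a k] and the coordinates with
   [0 < q j], and is strongly convex in them on bounded sets; the minimizers
   thus form a polyhedron, to which the Hoffman bound applies. *)
Lemma quadratic_growth : exists2 kappa, 0 <= kappa &
  forall x, polyhedron x -> phi x <= phi x0 -> exists z,
    [/\ polyhedron z, phi z = phi zs
      & forall j, `|x j - z j| <= kappa * Num.sqrt (phi x - phi zs)].
Proof.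
have [kap kap0 H] := bregman_strongly_convex a b w_gt0 q_ge0 B.
(* A coordinate with [q j = 0] contributes the zero form, so that all of [J] can serve as index. *)
pose E (l : K + J) := match l with
  | inl k => a k | inr j => fun j' => ((0 < q j)%R && (j' == j))%:R end.
have [kh kh0 HH] := polyhedron_error_bound c E.
have linE (j : J) z : lin (E (inr j)) z = (0 < q j)%R%:R * z j.
  rewrite /lin (bigD1 j)//= eqxx andbT big1 ?addr0// => j' /negbTE ->.
  by rewrite andbF mul0r.
exists (kh * Num.sqrt kap); first by rewrite mulr_ge0// sqrtr_ge0.
move=> x Px xx0; have xB := sublevel_bounded Px xx0.
have [Hk Hq] := H x zs xB zs_bounded.
(* Optimality of [zs] gives the linear term of the divergence the favourable sign. *)
have gap : bregman w a q b x zs <= phi x - phi zs.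
  rewrite /bregman gerBl.
  exact: (expquad_variational w_gt0 q_ge0 polyhedron_convex zs_min Px).
have sq r : r ^+ 2 <= kap * bregman w a q b x zs ->
    `|r| <= Num.sqrt kap * Num.sqrt (phi x - phi zs).
  move=> hr; rewrite -sqrtrM// -sqrtr_sqr ler_wsqrtr// (le_trans hr)//.
  exact: ler_wpM2l.
have [||z [Pz Ez xz]] :=
  HH beta x zs (Num.sqrt kap * Num.sqrt (phi x - phi zs)) _ Px zs_poly.
- by rewrite mulr_ge0// sqrtr_ge0.
- case=> [k|j]; first exact/sq/Hk.
  rewrite !linE -mulrBr; case: (ltP 0 (q j)) => [qj|_].
    by rewrite mul1r; apply/sq/Hq.
  by rewrite mul0r normr0 mulr_ge0// sqrtr_ge0.
exists z; split=> // [|j]; last by rewrite -mulrA.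
rewrite /expquad; congr (_ + _); apply: eq_bigr => i _.
  by rewrite (Ez (inl i)).
have [qi|qi] := ltP 0 (q i).
  by have := Ez (inr i); rewrite !linE qi !mul1r => ->.
have q0 : q i = 0 by apply/le_anti; rewrite qi q_ge0.
by rewrite b_eq0// q0 !mul0r.
Qed.

(** Let [gam] be the decrease over the cycle and [del] the gap after it. Convexity and the block
    variational inequalities bound [del] by a multiple of [sqrt gam * sqrt del], the second factor
    coming from quadratic growth. Squaring and cancelling [del] gives the last claim. *)
Lemma bcd_contraction : exists2 kappa, 0 <= kappa & forall x x',
  polyhedron x -> phi x <= phi x0 -> bcd_cycle x x' ->
  [/\ polyhedron x', phi x' <= phi x,
      forall j, (x j - x' j) ^+ 2 <= kappa * (phi x - phi x')
    & phi x' - phi zs <= kappa * (phi x - phi x')].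
Proof.
have [k1 k10 Hsc] := block_strongly_convex B.
have [k2 k20 Hgrow] := quadratic_growth.
have [L L0 HL] := expquad_grad_lipschitz a b w_gt0 q_ge0 B.
pose k3 := (#|J|%:R * (L * Num.sqrt k1 * k2)) ^+ 2.
have k30 : 0 <= k3 by exact: sqr_ge0.
exists (k1 + k3); first exact: addr_ge0.
move=> x x' Px xx0 [y [y0 ym ymin]].
have yP s : (s <= m)%N -> polyhedron (y s) /\ phi (y s) <= phi x.
  elim: s => [|s IH] sm; first by rewrite y0.
  have [[Ps _] mins] := ymin (Ordinal sm); split=> //=.
  have [Py yx] := IH (ltnW sm).
  by rewrite (le_trans _ yx)//; apply: mins; split.
have yB s : (s <= m)%N -> forall j, `|y s j| <= B.
  move=> /yP[Ps ps]; apply: sublevel_bounded => //; exact: le_trans ps xx0.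
have ystep (s : 'I_m) j : blk j != s -> y s.+1 j = y s j.
  by move=> js; have [[_ /(_ j js)]] := ymin s.
have ybefore s j : (s <= blk j)%N -> y s j = x j.
  elim: s => [|s IH] sj; first by rewrite y0.
  have sm : (s < m)%N := leq_trans sj (ltnW (ltn_ord (blk j))).
  rewrite -(IH (ltnW sj)); apply: (ystep (Ordinal sm)).
  by rewrite -val_eqE /= gtn_eqF.
have yafter s j : (blk j < s <= m)%N -> y s j = x' j.
  move=> /andP[js sm]; rewrite -ym.
  suff H n : (s <= n <= m)%N -> y n j = y s j by rewrite H ?sm ?leqnn.
  move=> /andP[]; elim: n => [|n IH]; first by rewrite leqn0 => /eqP ->.
  rewrite leq_eqVlt => /orP[/eqP -> //|]; rewrite ltnS => sn nm.
  rewrite -(IH sn (ltnW nm)); apply: (ystep (Ordinal nm)).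
  by rewrite -val_eqE /= ltn_eqF// (leq_trans js).
have yle s s' : (s <= s' <= m)%N -> phi (y s') <= phi (y s).
  move=> /andP[]; elim: s' => [|s' IH]; first by rewrite leqn0 => /eqP ->.
  rewrite leq_eqVlt => /orP[/eqP -> //|]; rewrite ltnS => ss' s'm.
  rewrite (le_trans _ (IH ss' (ltnW s'm)))//.
  have [_] := ymin (Ordinal s'm); apply; split=> //=.
  by have [] := yP s' (ltnW s'm).
have Px' : polyhedron x' by rewrite -ym; have [] := yP m (leqnn m).
have x'x : phi x' <= phi x by rewrite -ym; have [] := yP m (leqnn m).
have x'B j : `|x' j| <= B by rewrite -ym yB.
have gam0 : 0 <= phi x - phi x' by rewrite subr_ge0.
(* Coordinate [j] moves only in the step of its own block, so strong convexity of that block bounds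
   its move by the decrease in that step. *)
have dec j : (x j - x' j) ^+ 2 <= k1 * (phi x - phi x').
  have sm := ltn_ord (blk j); set s := blk j in sm *.
  have [Ps ps] := yP s (ltnW sm).
  have vi := expquad_variational w_gt0 q_ge0 (block_slice_convex (s := s) (x := y s))
    (ymin s) (conj Ps (fun _ _ => erefl)).
  have := Hsc s (y s) (y s.+1) (yB _ (ltnW sm)) (yB _ sm)
    (fun j js => esym (ystep s j js)) j.
  rewrite ybefore// yafter ?leqnn// => h; apply: (le_trans h).
  rewrite ler_wpM2l// /bregman; apply: (le_trans (_ : _ <= phi (y s) - phi (y s.+1))).
    by rewrite gerBl.
  rewrite lerB//.
  by rewrite -ym; apply: yle; rewrite sm leqnn.
split=> //.
  by move=> j; rewrite (le_trans (dec j))// ler_wpM2r// lerDl.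
have [z [Pz zE xz]] := Hgrow x' Px' (le_trans x'x xx0).
set del := phi x' - phi zs in xz *.
have del0 : 0 <= del by rewrite subr_ge0; exact: zs_le.
set gam := phi x - phi x' in gam0 dec *.
pose s1 := Num.sqrt k1 * Num.sqrt gam.
have mv j : `|x j - x' j| <= s1.
  by rewrite /s1 -sqrtrM// -sqrtr_sqr ler_wsqrtr.
(* The state right after the block of [j] was updated, where the optimality condition for [j] holds.
   It has the new values up to that block and the old ones beyond, hence is within [s1] of [x']. *)
pose Y j := y (blk j).+1.
have Yx j j' : `|x' j' - Y j j'| <= s1.
  rewrite /Y; have [lt|le] := ltnP (blk j') (blk j).+1.
    by rewrite yafter ?lt ?ltn_ord// subrr normr0 mulr_ge0 ?sqrtr_ge0.
  by rewrite ybefore// distrC.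
(* Test each block update with the block of [z], feasible by the product structure, and add up over
   the blocks. *)
have vi : 0 <= \sum_j grad (Y j) j * (z j - x' j).
  rewrite (partition_big blk predT)//= sumr_ge0// => s _.
  pose z' j := if blk j == s then z j else y s.+1 j.
  have Pz' : block_slice s (y s) z'.
    split; first by apply: polyhedron_product => //; have [] := yP s.+1 (ltn_ord s).
    by move=> j js; rewrite /z' (negbTE js) ystep.
  have := expquad_variational w_gt0 q_ge0 (block_slice_convex (s := s) (x := y s))
    (ymin s) Pz'.
  rewrite /lin (bigID (fun j => blk j == s)) /= [X in _ + X]big1 ?addr0; last first.
    by move=> j js; rewrite /z' (negbTE js) subrr mulr0.
  congr (_ <= _); apply: eq_bigr => j /eqP js.
  by rewrite /z' js eqxx /Y js [y s.+1 j]yafter// js leqnn ltn_ord.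
have bound : del <= #|J|%:R * (L * s1 * (k2 * Num.sqrt del)).
  have := expquad_convex a b w_gt0 q_ge0 z x'.
  rewrite zE => hc; have {hc} : del <= lin (grad x') (fun j => x' j - z j).
    rewrite !linB in hc *; move: hc; rewrite /del; lra.
  move=> /le_trans; apply.
  apply: (@le_trans _ _ (\sum_j (grad x' j - grad (Y j) j) * (x' j - z j))).
    rewrite /lin -subr_ge0 -sumrB; apply: (le_trans vi).
    by apply: ler_sum => j _; lra.
  apply: (le_trans (ler_norm _)); apply: sumr_bound => j.
  rewrite normrM ler_pM//; apply: HL => //; exact/yB/ltn_ord.
rewrite mulrDl; apply: ler_wpDl; first exact: mulr_ge0.
have [->|delp] := eqVneq del 0; first exact: mulr_ge0.
have {}delp : 0 < del by rewrite lt_def delp.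
rewrite -(ler_pM2r delp).
have -> : k3 * gam * del = (#|J|%:R * (L * s1 * (k2 * Num.sqrt del))) ^+ 2.
  rewrite /k3 /s1 -{1}(sqr_sqrtr gam0) -{1}(sqr_sqrtr del0); ring.
by rewrite -expr2 ler_pXn2r ?nnegrE// ?(le_trans del0 bound).
Qed.

Theorem bcd_linear_convergence (x : nat -> J -> R) :
  x 0%N = x0 -> (forall k, bcd_cycle (x k) (x k.+1)) ->
  exists xs (C rho : R), [/\ is_minimizer polyhedron phi xs, 0 <= rho < 1
    & forall k j, `|x k j - xs j| <= C * rho ^+ k].
Proof.
move=> x00 xcyc; have [kap kap0 H] := bcd_contraction.
have xP k : polyhedron (x k) /\ phi (x k) <= phi x0.
  elim: k => [|k [Pk pk]]; first by rewrite x00.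
  have [P' le' _ _] := H _ _ Pk pk (xcyc k); split=> //; exact: le_trans pk.
pose gap k := phi (x k) - phi zs.
have gap0 k : 0 <= gap k by rewrite subr_ge0; apply: zs_le; have [] := xP k.
(* Solving [gap k.+1 <= kap * (gap k - gap k.+1)] for [gap k.+1] gives this factor. Steps are
   bounded by the square root of the gap, so the iterates contract with [sqrt theta]. *)
pose theta := kap / (1 + kap).
have k1 : 0 < 1 + kap by lra.
have th0 : 0 <= theta by rewrite divr_ge0// ltW.
have th1 : theta < 1 by rewrite ltr_pdivrMr//; lra.
have gapS k : gap k.+1 <= theta * gap k.
  have [Pk pk] := xP k; have [_ _ _ h] := H _ _ Pk pk (xcyc k).
  rewrite /theta mulrAC ler_pdivlMr//; move: h; rewrite /gap; lra.
have gapk k : gap k <= theta ^+ k * gap 0%N.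
  elim: k => [|k IH]; first by rewrite expr0 mul1r.
  by rewrite (le_trans (gapS k))// exprS -mulrA ler_wpM2l.
pose rho := Num.sqrt theta.
have r01 : 0 <= rho < 1.
  rewrite sqrtr_ge0 /=; rewrite -[X in _ < X]sqrtr1 ltr_sqrt//.
have mv k j : `|x k j - x k.+1 j| <= Num.sqrt (kap * gap 0%N) * rho ^+ k.
  have [Pk pk] := xP k; have [P' le' h _] := H _ _ Pk pk (xcyc k).
  have rk0 : 0 <= rho ^+ k by rewrite exprn_ge0//; case/andP: r01.
  rewrite -(ler_pXn2r (ltn0Sn 1)) ?nnegrE ?mulr_ge0 ?sqrtr_ge0//.
  rewrite exprMn exprAC (sqr_sqrtr th0) (sqr_sqrtr (mulr_ge0 kap0 (gap0 0%N))).
  rewrite real_normK ?num_real//.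
  rewrite (le_trans (h j))// -mulrA ler_wpM2l// mulrC (le_trans _ (gapk k))//.
  by rewrite /gap lerD2l lerN2; apply: zs_le.
have /choice[xs xsE] : forall j, exists l, forall k,
    `|x k j - l| <= Num.sqrt (kap * gap 0%N) / (1 - rho) * rho ^+ k.
  by move=> j; apply: geometric_cauchy => // k.
set C := _ / _ in xsE.
have Pxs : polyhedron xs.
  move=> i; apply: (@le_geometric_perturbation _ _ _ (\sum_j `|c i j| * C) rho) => // k.
  have : lin (c i) xs - lin (c i) (x k) <= (\sum_j `|c i j| * C) * rho ^+ k.
    rewrite -linB (le_trans (ler_norm _))// (le_trans (ler_norm_sum _ _ _))//.
    rewrite mulr_suml ler_sum// => j _; rewrite normrM -mulrA ler_wpM2l//.
    by rewrite distrC.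
  by have := (xP k).1 i; lra.
(* The limit is optimal: the tangent inequality at [xs] bounds [phi xs - phi zs] by the gap at [x k]
   plus a multiple of the distance from [x k] to [xs], and both decay geometrically. *)
exists xs, C, rho; split=> //; split=> // z /zs_le; apply: le_trans.
rewrite -subr_le0.
apply: (@le_geometric_perturbation _ _ _ (gap 0%N + \sum_j `|grad xs j| * C) rho) => // k.
rewrite add0r mulrDl.
have hc := expquad_convex a b w_gt0 q_ge0 (x k) xs.
have h1 : gap k <= gap 0%N * rho ^+ k.
  have /andP[r0 r1] := r01.
  have thr : theta <= rho by rewrite -(sqr_sqrtr th0) expr2 ler_piMr// ltW.
  by rewrite (le_trans (gapk k))// mulrC ler_wpM2l// lerXn2r.
have h2 : - lin (grad xs) (fun j => x k j - xs j) <= (\sum_j `|grad xs j| * C) * rho ^+ k.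
  rewrite (le_trans (ler_norm _))// normrN (le_trans (ler_norm_sum _ _ _))//.
  by rewrite mulr_suml ler_sum// => j _; rewrite normrM -mulrA ler_wpM2l.
move: h1 h2 hc; rewrite /gap; lra.
Qed.

End Convergence.
End BlockCoordinateDescent.

(** * Existence of minimizers *)

Section ExpquadContinuity.
Context {R : realType} {X : topologicalType}.

Lemma sum_continuous (I : finType) (F : I -> X -> R) :
  (forall i, continuous (F i)) -> continuous (fun z => \sum_i F i z).
Proof.
by move=> cF; apply: continuous_big => //; exact: add_continuous.
Qed.

Variables (J : finType) (p : J -> X -> R).
Hypothesis p_continuous : forall j, continuous (p j).

Lemma comp_lin_continuous (a : J -> R) : continuous (fun z => lin a (p ^~ z)).
Proof.
apply: sum_continuous => j z; apply: cvgM; first exact: cvg_cst.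
exact: p_continuous.
Qed.

Lemma comp_expquad_continuous (K : finType) (w : K -> R) (a : K -> J -> R) q b :
  continuous (fun z => expquad w a q b (p ^~ z)).
Proof.
move=> z; apply: cvgD; apply: sum_continuous => {z} i z.
  apply: cvgM; first exact: cvg_cst.
  apply: continuous_comp; [exact: comp_lin_continuous|exact: continuous_expR].
have ci := @p_continuous i z.
apply: cvgB; apply: cvgM; [exact: cvg_cst| |exact: cvg_cst|exact: ci].
exact: (cvgM ci ci).
Qed.

End ExpquadContinuity.

Section Existence.
Context {R : realType} {J : finType}.
Implicit Types (C : set {ptws J -> R}).

Lemma coord_continuous (j : J) : continuous (fun z : {ptws J -> R} => z j).
Proof. exact: (@proj_continuous J (fun=> R) j). Qed.

Lemma lin_continuous (a : J -> R) : continuous (lin a : {ptws J -> R} -> R).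
Proof. exact: (comp_lin_continuous coord_continuous). Qed.

Lemma expquad_continuous (K : finType) (w : K -> R) (a : K -> J -> R) q b :
  continuous (expquad w a q b : {ptws J -> R} -> R).
Proof. exact: (comp_expquad_continuous coord_continuous). Qed.

Lemma closed_halfspace (a : J -> R) (beta : R) :
  closed [set z : {ptws J -> R} | lin a z <= beta].
Proof.
apply: (@closed_comp _ _ (lin a : {ptws J -> R} -> R) [set r | r <= beta]).
  by move=> z _; exact: lin_continuous.
exact: closed_le.
Qed.

Lemma closed_coord_eq (j : J) (r : R) : closed [set z : {ptws J -> R} | z j = r].
Proof.
apply: (@closed_comp _ _ (fun z : {ptws J -> R} => z j) [set r]).
  by move=> z _; exact: coord_continuous.
exact: closed_eq.
Qed.

(** In the product topology boxes are compact by Tychonoff, so [f] attains a minimum on the part of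
    [C] inside the box. Points outside the box have values above [f z0]. *)
Lemma bounded_sublevel_min C (f : {ptws J -> R} -> R) z0 B :
  closed C -> continuous f -> C z0 ->
  (forall z, C z -> f z <= f z0 -> forall j, `|z j| <= B) ->
  exists z, is_minimizer C f z.
Proof.
move=> cC cf Cz0 Cbnd.
pose box : set {ptws J -> R} := [set z | forall j, `[- B, B]%classic (z j)].
have cbox : compact box.
  exact: (@tychonoff J (fun=> R) (fun=> `[- B, B]%classic)
    (fun=> @segment_compact R (- B) B)).
have inbox z : C z -> f z <= f z0 -> box z.
  by move=> Cz fz j; rewrite /= in_itv /= -ler_norml; exact: Cbnd.
have [|||z] := @compact_EVT_min {ptws J -> R} R f (box `&` C).
- by exists z0; split=> //; exact: inbox.
- exact: compact_closedI.
- exact: continuous_subspaceT.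
rewrite inE => -[_ Cz] zmin; exists z; split=> // y Cy.
have [fy|/ltW fy] := leP (f y) (f z0).
  by apply: zmin; rewrite inE; split=> //; exact: inbox.
by apply: le_trans fy; apply: zmin; rewrite inE; split=> //; exact: inbox.
Qed.

End Existence.

(** * Coercivity in the coordinates with a quadratic term *)

Section QuadraticBound.
Context {R : realType} {J K : finType}.
Variables (w : K -> R) (a : K -> J -> R) (q b : J -> R).
Hypothesis w_gt0 : forall k, 0 < w k.
Hypothesis q_ge0 : forall j, 0 <= q j.
Hypothesis b_eq0 : forall j, q j = 0 -> b j = 0.

Lemma expquad_sublevel_bounded (r : R) : exists B : R, forall z,
  expquad w a q b z <= r -> forall j, 0 < q j -> `|z j| <= B.
Proof.
(* Minus the minimum of the [j]-th parabola. For [q j = 0] it is [0], since division by zero yields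
   [0], matching [b j = 0]. *)
pose e j := b j ^+ 2 / (2 * q j).
have lb j t : - e j <= q j / 2 * t ^+ 2 - b j * t.
  have := q_ge0 j; rewrite le_eqVlt => /orP[/eqP q0|qj].
    by rewrite /e b_eq0// -q0 !mul0r expr0n /= mul0r !oppr0 addr0.
  rewrite -subr_ge0 (_ : _ - _ = q j / 2 * (t - b j / q j) ^+ 2); last first.
    by rewrite /e; field; lra.
  by rewrite mulr_ge0 ?sqr_ge0// divr_ge0.
have e0 j : 0 <= e j by rewrite divr_ge0 ?sqr_ge0// mulr_ge0.
pose S := `|r| + \sum_j e j.
have S0 : 0 <= S by rewrite addr_ge0// sumr_ge0.
(* Beyond this radius the [j]-th parabola alone exceeds [S]; the summand [1] ensures
   [S <= S * |z j|]. *)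
pose Bj j := 1 + 2 * (S + `|b j|) / q j.
have Bj0 j : 0 <= Bj j by rewrite addr_ge0// divr_ge0// mulr_ge0// addr_ge0.
exists (\sum_j Bj j) => z zr j qj.
apply: (le_trans _ (le_sum_nneg j Bj0)).
have hj : q j / 2 * z j ^+ 2 - b j * z j <= S.
  have h1 : \sum_i (q i / 2 * z i ^+ 2 - b i * z i) <= `|r|.
    apply: le_trans (ler_norm r); apply: le_trans zr; rewrite /expquad lerDr.
    by apply: sumr_ge0 => k _; rewrite mulr_ge0 ?expR_ge0// ltW.
  have h2 : q j / 2 * z j ^+ 2 - b j * z j + e j <=
      \sum_i (q i / 2 * z i ^+ 2 - b i * z i + e i).
    apply: (@le_sum_nneg _ _ (fun i => q i / 2 * z i ^+ 2 - b i * z i + e i)) => i.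
    by have := lb i (z i); lra.
  move: h2; rewrite big_split /=; have := e0 j; rewrite /S; lra.
rewrite leNgt; apply/negP => Bz.
have z1 : 1 <= `|z j|.
  by rewrite (le_trans _ (ltW Bz))// lerDl divr_ge0// mulr_ge0// addr_ge0.
have z2 : 2 * (S + `|b j|) < q j * `|z j|.
  by rewrite [ltRHS]mulrC -ltr_pdivrMr//; apply: le_lt_trans Bz; rewrite lerDr.
have z3 : q j / 2 * z j ^+ 2 <= S + `|b j| * `|z j|.
  by have := ler_norm (b j * z j); rewrite normrM; lra.
have z4 : z j ^+ 2 = `|z j| ^+ 2 by rewrite real_normK ?num_real.
move: z3; rewrite z4; set t := `|z j| in z1 z2 *.
have := normr_ge0 (b j); set bb := `|b j| in z2 *; move=> bb0.
by nra.
Qed.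

End QuadraticBound.

(** * Contraction of chain tensors *)

Section ChainSums.
Context {R : realType} {N : nat}.
Variable Km : 'M[R]_N.

Definition cons_index (A : Type) n (j : A) (i : 'I_n -> A) : 'I_n.+1 -> A :=
  fun t => oapp i j (unlift ord0 t).

Lemma sum_ffun_recl n (A : finType) (f : {ffun 'I_n.+1 -> A} -> R) :
  \sum_i f i = \sum_j \sum_(i : {ffun 'I_n -> A}) f (finfun (cons_index j i)).
Proof.
rewrite pair_big /=.
rewrite (reindex (fun p : A * {ffun 'I_n -> A} => finfun (cons_index p.1 p.2)))//.
apply: onW_bij.
exists (fun i : {ffun 'I_n.+1 -> A} => (i ord0, [ffun t => i (lift ord0 t)])).
  move=> [j i] /=; rewrite ffunE /cons_index unlift_none; congr (_, _).
  by apply/ffunP => t; rewrite !ffunE liftK.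
move=> i; apply/ffunP => t; rewrite ffunE /cons_index /=.
by case: unliftP => [t'|] -> //=; rewrite ffunE.
Qed.

Definition chain_weight n (g : 'I_n -> 'I_N) : R :=
  \prod_(p : 'I_n * 'I_n | val p.2 == (val p.1).+1) Km (g p.1) (g p.2).

Lemma chain_weight_recl n (g : 'I_n.+2 -> 'I_N) :
  chain_weight g = Km (g ord0) (g (lift ord0 ord0)) * chain_weight (g \o lift ord0).
Proof.
have E k (h : 'I_k -> 'I_N) : chain_weight h =
    \prod_s \prod_(t : 'I_k | val t == (val s).+1) Km (h s) (h t).
  rewrite /chain_weight.
  by rewrite (pair_big_dep predT (fun s t : 'I_k => val t == (val s).+1)
    (fun s t => Km (h s) (h t))).
rewrite !E big_ord_recl; congr (_ * _).
  by rewrite (big_pred1 (lift ord0 ord0)).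
apply: eq_bigr => s _; rewrite big_mkcond big_ord_recl /= mul1r.
by rewrite -big_mkcond; apply: eq_bigl => t.
Qed.

(** Transfer-matrix evaluation: summing out one mode is one application of [Km]. The result is the
    fold that defines [wvec]. *)
Lemma chain_sum_cons n (a : 'I_n -> 'cV[R]_N) (j : 'I_N) :
  \sum_(i : {ffun 'I_n -> 'I_N})
     (\prod_t a t (i t) 0) * chain_weight (cons_index j i)
  = foldr (fun s h => Km *m hadv (a s) h) (const_mx 1) (enum 'I_n) j 0.
Proof.
elim: n a j => [|n IH] a j.
  rewrite enum_ord0 /= mxE (eq_bigr (fun=> 1)); last first.
    move=> i _; rewrite big_ord0 mul1r /chain_weight big1// => -[s t] /=.
    by rewrite (ord1 s) (ord1 t).
  by rewrite sumr_const card_ffun !card_ord expn0.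
rewrite sum_ffun_recl enum_ordSl /= foldr_map mxE; apply: eq_bigr => k _.
rewrite mxE -IH !mulr_sumr; apply: eq_bigr => i _.
rewrite big_ord_recl ffunE chain_weight_recl /cons_index unlift_none.
rewrite liftK /= ffunE unlift_none /=.
under eq_bigr do rewrite ffunE liftK /=.
rewrite (_ : _ \o _ = cons_index k i); last first.
  by apply/funext => t /=; rewrite liftK /= ffunE.
rewrite unlift_none /= -/(cons_index k i); ring.
Qed.

End ChainSums.

Section Marginals.
Context {R : realType} {N : nat} {Theta : Type}.
Variables (theta : 'I_N -> Theta) (c : Theta -> Theta -> R) (eps : R).
Local Notation Km := (kernel_mx theta c eps).

Lemma kernel_tensorE T i :
  kernel_tensor theta c eps T i = chain_weight Km (i : {ffun 'I_T -> 'I_N}).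
Proof.
rewrite ffunE /cost_tensor ffunE /chain_weight.
rewrite -sumrN mulr_suml expR_sum; apply: eq_bigr => p _.
by rewrite mxE.
Qed.

Lemma dotv_mulmx m n (A : 'M[R]_(m, n)) x y : dotv x (A *m y) = dotv (A^T *m x) y.
Proof.
rewrite /dotv; under eq_bigr do rewrite mxE mulr_sumr.
rewrite exchange_big; apply: eq_bigr => j _ /=.
rewrite mxE mulr_suml; apply: eq_bigr => i _; rewrite mxE; ring.
Qed.

Lemma dotv_hadv n (x y z : 'cV[R]_n) : dotv x (hadv y z) = dotv (hadv x y) z.
Proof. by apply: eq_bigr => i _; rewrite !mxE mulrA. Qed.

Lemma dotvC n (x y : 'cV[R]_n) : dotv x y = dotv y x.
Proof. by apply: eq_bigr => i _; rewrite mulrC. Qed.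

Lemma hadvC n (x y : 'cV[R]_n) : hadv x y = hadv y x.
Proof. by apply/matrixP => i j; rewrite !mxE mulrC. Qed.

(* By duality of [Km] and its transpose, the right-hand side does not depend
   on [t]; for [t = 0] it is the sum evaluated from the last mode backwards. *)
Lemma dott_outer_kernel T (a : 'I_T -> 'cV[R]_N) (t : 'I_T) :
  dott (outer a) (kernel_tensor theta c eps T) = dotv (a t) (xi Km a t).
Proof.
case: T a t => [|T] a t; first by case: t.
case: t => t; elim: t => [|t IH] tT.
  have -> : Ordinal tT = ord0 by apply: val_inj.
  rewrite /xi what_first// /wvec enum_ordSl /= drop0 foldr_map.
  rewrite /dott sum_ffun_recl; apply: eq_bigr => j _.
  rewrite !mxE mulr1 -chain_sum_cons mulr_sumr; apply: eq_bigr => i _.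
  rewrite kernel_tensorE ffunE big_ord_recl ffunE {1}/cons_index unlift_none /=.
  rewrite -mulrA; congr (_ * (_ * _)).
    by apply: eq_bigr => s _; rewrite ffunE /cons_index liftK.
  by congr chain_weight; apply/funext => s; rewrite ffunE.
have sT := ltnW tT; rewrite (IH sT).
have ts : Ordinal tT = (Ordinal sT).+1 :> nat by [].
rewrite /xi (wvec_prev _ _ ts) (what_next _ _ ts).
by rewrite (hadvC (Km *m _)) !dotv_hadv dotv_mulmx dotvC.
Qed.

Lemma eq_in_foldl (A B : eqType) (f g : A -> B -> A) (s : seq B) z :
  (forall x, x \in s -> f ^~ x =1 g ^~ x) -> foldl f z s = foldl g z s.
Proof.
elim: s z => //= x s IH z fg; rewrite fg ?mem_head// IH// => y ys.
by apply: fg; rewrite inE ys orbT.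
Qed.

Lemma eq_in_foldr (A B : eqType) (f g : B -> A -> A) (s : seq B) z :
  (forall x, x \in s -> f x =1 g x) -> foldr f z s = foldr g z s.
Proof.
elim: s => //= x s IH fg; rewrite fg ?mem_head// IH// => y ys.
by apply: fg; rewrite inE ys orbT.
Qed.

(** The two folds run over the modes strictly before and strictly after [t]. Hence [xi] stays
    correct while the block of mode [t] varies. *)
Lemma eq_xi T (a a' : 'I_T -> 'cV[R]_N) (t : 'I_T) :
  (forall s, s != t -> a s = a' s) -> xi Km a t = xi Km a' t.
Proof.
move=> aa; rewrite /xi /wvec /what; congr hadv.
  apply: eq_in_foldr => s /(map_f val); rewrite map_drop val_enum_ord drop_iota.
  by rewrite mem_iota => /andP[ts _] h; rewrite aa// -val_eqE gtn_eqF.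
apply: eq_in_foldl => s /(map_f val); rewrite map_take val_enum_ord take_iota.
rewrite mem_iota => /andP[_ st] h; rewrite aa// -val_eqE ltn_eqF//.
by apply: (leq_trans st); rewrite add0n geq_minl.
Qed.

End Marginals.

(** * The dual problem in coordinates *)

(** The sum of absolute values is the largest signed sum, attained at the signs of [v]. This writes
    the norm constraint as finitely many linear inequalities. *)
Lemma signed_sums_le (R : realType) (F : nat) (v : 'I_F -> R) (eta : R) :
  (forall s : {ffun 'I_F -> bool}, \sum_f (-1) ^+ s f * v f <= eta) <->
  \sum_f `|v f| <= eta.
Proof.
split=> [H|H s].
  rewrite (le_trans _ (H [ffun f => v f < 0]))// ler_sum// => f _.
  by rewrite ffunE mulr_sign; case: ltP => h; [rewrite ltr0_norm|rewrite ger0_norm].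
apply: le_trans H; apply: ler_sum => f _.
by rewrite (le_trans (ler_norm _))// normrMsign.
Qed.

Lemma norm_1inf_le (R : realType) N F (A : 'M[R]_(N, F)) (eta : R) : 0 <= eta ->
  norm_1inf A <= eta <-> forall i, \sum_f `|A i f| <= eta.
Proof.
move=> eta0; split=> [H i|H]; last by apply/bigmax_leP.
by apply: le_trans H; apply: (le_bigmax_cond _ (fun i => \sum_f `|A i f|)).
Qed.

Lemma hadtE (R : realType) N T (X Y : tensor R N T) i : hadt X Y i = X i * Y i.
Proof. by rewrite ffunE. Qed.

Section Flattening.
Context {R : realType} {N F T d : nat} {Theta : Type}.
Variables (eps gamma eta : R).
Hypotheses (eps_gt0 : 0 < eps) (gamma_gt0 : 0 < gamma) (eta_gt0 : 0 < eta).
Variables (G : 'I_F -> 'M[R]_(d, N)) (r : 'I_F -> 'I_T -> 'cV[R]_d).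
Variables (theta : 'I_N -> Theta) (c : Theta -> Theta -> R).
Implicit Types (x y : dual_var R N F T d).

Definition coord : finType := ('I_F * 'I_T * 'I_d + 'I_T * 'I_N * 'I_F)%type.
Definition expterm : finType := ('I_F * {ffun 'I_T -> 'I_N})%type.
(* One inequality for each choice of signs in [\sum_f |psi_f| <= eta]. *)
Definition constr : finType := ('I_T * 'I_N * {ffun 'I_F -> bool})%type.

Definition flat x : coord -> R := fun j => match j with
  | inl (f, t, l) => lam x f t l 0 | inr (t, n, f) => psi x t n f end.

Definition unflat (z : coord -> R) : dual_var R N F T d :=
  DualVar (fun f t => \col_l z (inl (f, t, l)))
          (fun t => \matrix_(n, f) z (inr (t, n, f))).

Lemma unflatK z : flat (unflat z) = z.
Proof.
by apply/funext => -[[[f t] l]|[[t n] f]] /=; rewrite mxE.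
Qed.

Definition exp_coef (k : expterm) (j : coord) : R := match j with
  | inl (f, t, l) => (f == k.1)%:R * (eps^-1 * G f l (k.2 t))
  | inr (t, n, f) => (f == k.1)%:R * ((n == k.2 t)%:R * eps^-1) end.
Definition exp_weight (k : expterm) : R := eps * kernel_tensor theta c eps T k.2.
Definition quad_coef (j : coord) : R := if j is inl _ then gamma^-1 else 0.
Definition lin_coef (j : coord) : R :=
  if j is inl (f, t, l) then r f t l 0 else 0.
Definition constr_coef (i : constr) (j : coord) : R :=
  if j is inr (t, n, f) then ((t == i.1.1) && (n == i.1.2))%:R * (-1) ^+ i.2 f
  else 0.
(** The order of ['I_(T + T)] is the order of a sweep: all [lam] blocks, then all [psi] blocks. A
    block gathers all [f] at one mode. *)
Definition block (j : coord) : 'I_(T + T) := match j with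
  | inl (f, t, l) => lshift T t | inr (t, n, f) => rshift T t end.

Local Notation phi := (expquad exp_weight exp_coef quad_coef lin_coef).
Local Notation feas := (polyhedron constr_coef (fun=> eta)).

Lemma sum_coord (g : coord -> R) : \sum_j g j =
  \sum_f \sum_t \sum_l g (inl (f, t, l)) + \sum_t \sum_n \sum_f g (inr (t, n, f)).
Proof.
rewrite big_sumType /=; congr (_ + _).
  rewrite (pair_bigA _ (fun f t => \sum_l g (inl (f, t, l)))) pair_bigA /=.
  by apply: eq_bigr => -[[f t] l].
rewrite (pair_bigA _ (fun t n => \sum_f g (inr (t, n, f)))) pair_bigA /=.
by apply: eq_bigr => -[[f t] l].
Qed.

Lemma sum_pick (I : finType) (i : I) (g : I -> R) :
  \sum_j (j == i)%:R * g j = g i.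
Proof.
rewrite (bigD1 i)//= eqxx mul1r big1 ?addr0// => j /negbTE ->; exact: mul0r.
Qed.

Lemma lin_exp_coef f i x : lin (exp_coef (f, i)) (flat x) =
  \sum_t (eps^-1 * ((G f)^T *m lam x f t) (i t) 0 + eps^-1 * psi x t (i t) f).
Proof.
rewrite /lin sum_coord big_split /=; congr (_ + _).
  under eq_bigr => f' _.
    under eq_bigr => t _ do (under eq_bigr do rewrite -mulrA; rewrite -mulr_sumr).
    rewrite -mulr_sumr; over.
  rewrite sum_pick; apply: eq_bigr => t _.
  by rewrite mxE mulr_sumr; apply: eq_bigr => l _; rewrite !mxE mulrA.
apply: eq_bigr => t _.
under eq_bigr => n _ do (under eq_bigr do rewrite -!mulrA; rewrite sum_pick).
by rewrite sum_pick.
Qed.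

Lemma expR_lin_exp_coef f i x : expR (lin (exp_coef (f, i)) (flat x)) =
  outer (uvec eps G x f) i * outer (vvec eps x f) i.
Proof.
rewrite lin_exp_coef expR_sum !ffunE -big_split; apply: eq_bigr => t _.
by rewrite expRD !mxE.
Qed.

Lemma expquad_flat x : phi (flat x) = dual_objective eps gamma G r theta c x.
Proof.
rewrite /expquad /dual_objective; congr (_ + _).
  rewrite -(pair_bigA _ (fun f i => exp_weight (f, i) *
    expR (lin (exp_coef (f, i)) (flat x)))) /=.
  apply: eq_bigr => f _; rewrite /dott mulr_sumr; apply: eq_bigr => i _.
  rewrite expR_lin_exp_coef hadtE /exp_weight /=; ring.
rewrite sum_coord /= [X in _ + X]big1 ?addr0; last first.
  by move=> t _; rewrite big1// => n _; rewrite big1// => f _; rewrite !mul0r subr0.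
rewrite exchange_big; apply: eq_bigr => t _; apply: eq_bigr => f _.
rewrite /normsq /dotv mulr_sumr -sumrB; apply: eq_bigr => l _.
by rewrite invfM (mulrC (r f t l 0)); ring.
Qed.

Lemma lin_constr_coef t n s z :
  lin (constr_coef (t, n, s)) z = \sum_f (-1) ^+ s f * z (inr (t, n, f)).
Proof.
rewrite /lin sum_coord [X in X + _]big1 ?add0r; last first.
  by move=> f _; rewrite big1// => t' _; rewrite big1// => l _; rewrite mul0r.
rewrite /= (bigD1 t)//= [X in _ + X]big1 ?addr0; last first.
  move=> t' /negbTE tt; rewrite big1// => n' _; rewrite big1// => f _.
  by rewrite tt !mul0r.
rewrite (bigD1 n)//= [X in _ + X]big1 ?addr0; last first.
  by move=> n' /negbTE nn; rewrite big1// => f _; rewrite nn andbF !mul0r.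
by apply: eq_bigr => f _; rewrite !eqxx mul1r.
Qed.

Lemma polyhedronE z : feas z <-> forall t n, \sum_f `|z (inr (t, n, f))| <= eta.
Proof.
split=> [H t n|H [[t n] s]]; last first.
  by rewrite lin_constr_coef; have /signed_sums_le := H t n; apply.
by apply/signed_sums_le => s; rewrite -lin_constr_coef; exact: H.
Qed.

Lemma polyhedron_flat x : feas (flat x) <-> dual_feasible eta x.
Proof.
split=> [/polyhedronE H t|H].
  by apply/(norm_1inf_le _ (ltW eta_gt0)) => n; exact: H.
apply/polyhedronE => t n.
by have /(norm_1inf_le _ (ltW eta_gt0)) := H t; apply.
Qed.

Lemma exp_weight_gt0 k : 0 < exp_weight k.
Proof. by rewrite mulr_gt0// ffunE expR_gt0. Qed.

Lemma quad_coef_ge0 j : 0 <= quad_coef j.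
Proof. by case: j => [j|j]; [rewrite /= invr_ge0 ltW|exact: lexx]. Qed.

Lemma lin_coef_eq0 j : quad_coef j = 0 -> lin_coef j = 0.
Proof.
by case: j => [[[f t] l]|j] //= H; have := gamma_gt0; rewrite -invr_gt0 H ltxx.
Qed.

(** For a [psi] coordinate [(t, n, f)], the exponent at [f] and the constant multi-index [n]
    involves no other coordinate of the block of mode [t]. *)
Lemma block_separation j : 0 < quad_coef j \/
  exists2 k, exp_coef k j != 0
    & forall j', block j' = block j -> j' != j -> exp_coef k j' = 0.
Proof.
case: j => [[[f t] l]|[[t n] f]]; first by left; rewrite /= invr_gt0.
right; exists (f, [ffun=> n]).
  by rewrite /= ffunE !eqxx !mul1r invr_eq0 gt_eqF.
case=> [[[f' t'] l]|[[t' n'] f']] /= E.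
  by move: E => /eqP; rewrite eq_lrshift.
move/rshift_inj: E => ->; rewrite ffunE.
case: (eqVneq f' f) => [->|]; last by rewrite mul0r.
case: (eqVneq n' n) => [->|]; last by rewrite mul0r mulr0.
by rewrite eqxx.
Qed.

Lemma polyhedron_product s (z y : coord -> R) : feas z -> feas y ->
  feas (fun j => if block j == s then z j else y j).
Proof.
move=> /polyhedronE Hz /polyhedronE Hy; apply/polyhedronE => t n /=.
by case: eqP.
Qed.

Lemma psi_bound (z : coord -> R) t n f : \sum_f `|z (inr (t, n, f) : coord)| <= eta ->
  `|z (inr (t, n, f) : coord)| <= eta.
Proof.
by apply: le_trans; apply: (@le_sum_nneg _ _ (fun f => `|z (inr (t, n, f))|)).
Qed.

(** The quadratic term bounds [lam], the norm constraint bounds [psi]. *)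
Lemma feasible_sublevel_bounded p : exists B : R, forall z,
  feas z -> phi z <= p -> forall j, `|z j| <= B.
Proof.
have [B HB] := expquad_sublevel_bounded exp_coef exp_weight_gt0 quad_coef_ge0
  lin_coef_eq0 p.
exists (Num.max B eta) => z /polyhedronE Pz zp; case=> [j|[[t n] f]].
  by rewrite le_max HB//= invr_gt0.
by rewrite le_max orbC psi_bound.
Qed.

End Flattening.

Lemma dott_hadt_outer (R : realType) N T (u v : 'I_T -> 'cV[R]_N) (M : tensor R N T) :
  dott (outer u) (hadt (outer v) M) = dott (outer (fun t => hadv (u t) (v t))) M.
Proof.
apply: eq_bigr => i _; rewrite !ffunE mulrA -big_split; congr (_ * _).
by apply: eq_bigr => t _; rewrite mxE.
Qed.

(** * The updates as exact block minimizations of the dual objective *)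

Section BlockUpdates.
Context {R : realType} {N F T d : nat} {Theta : Type}.
Variables (eps gamma eta : R).
Hypotheses (eps_gt0 : 0 < eps) (gamma_gt0 : 0 < gamma) (eta_gt0 : 0 < eta).
Variables (G : 'I_F -> 'M[R]_(d, N)) (r : 'I_F -> 'I_T -> 'cV[R]_d).
Variables (theta : 'I_N -> Theta) (c : Theta -> Theta -> R).
Implicit Types (x y : dual_var R N F T d).

Local Notation phi := (expquad (exp_weight eps theta c) (exp_coef eps G)
  (@quad_coef R N F T d gamma) (lin_coef r)).
Local Notation feas := (polyhedron (@constr_coef R N F T d) (fun=> eta)).
Local Notation dual := (dual_objective eps gamma G r theta c).

Definition lam_cost (f : 'I_F) (t : 'I_T) (l : 'cV[R]_d) : R :=
  (2 * gamma)^-1 * normsq l - dotv l (r f t).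

Definition lam_obj x f t (l : 'cV[R]_d) : R :=
  eps * dotv (expv (eps^-1 *: ((G f)^T *m l)))
             (hadv (vvec eps x f t) (xi_cur eps G theta c x f t))
  + (2 * gamma)^-1 * normsq l - dotv l (r f t).

Definition psi_obj x t (P : 'M[R]_(N, F)) : R :=
  \sum_f eps * dotv (expv (eps^-1 *: col f P))
                    (hadv (uvec eps G x f t) (xi_cur eps G theta c x f t)).

Lemma dott_dual_block x y f t :
  (forall s, s != t -> uvec eps G y f s = uvec eps G x f s) ->
  (forall s, s != t -> vvec eps y f s = vvec eps x f s) ->
  dott (outer (uvec eps G y f))
       (hadt (outer (vvec eps y f)) (kernel_tensor theta c eps T))
  = dotv (uvec eps G y f t) (hadv (vvec eps y f t) (xi_cur eps G theta c x f t)).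
Proof.
move=> yxu yxv; rewrite dott_hadt_outer (dott_outer_kernel _ _ _ _ t) dotv_hadv.
by congr dotv; apply: eq_xi => s st; rewrite yxu// yxv.
Qed.

Lemma dual_objective_lam_block x y t : psi y = psi x ->
  (forall f s, s != t -> lam y f s = lam x f s) ->
  dual y = \sum_f lam_obj x f t (lam y f t)
           + \sum_(s | s != t) \sum_f lam_cost f s (lam x f s).
Proof.
move=> yx lyx; rewrite /dual_objective (bigD1 t)//= addrA -big_split /=.
congr (_ + _); last first.
  by apply: eq_bigr => s st; apply: eq_bigr => f _; rewrite lyx.
apply: eq_bigr => f _; rewrite /lam_obj -addrA; congr (_ * _ + _).
have vE s : vvec eps y f s = vvec eps x f s by rewrite /vvec yx.
rewrite (@dott_dual_block x y f t)// => [|s st]; first by rewrite vE.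
by rewrite /uvec lyx.
Qed.

Lemma dual_objective_psi_block x y t : lam y = lam x ->
  (forall s, s != t -> psi y s = psi x s) ->
  dual y = psi_obj x t (psi y t) + \sum_s \sum_f lam_cost f s (lam x f s).
Proof.
move=> yx pyx; rewrite /dual_objective yx; congr (_ + _).
apply: eq_bigr => f _; congr (_ * _).
have uE s : uvec eps G y f s = uvec eps G x f s by rewrite /uvec yx.
rewrite (@dott_dual_block x y f t)// => [|s st]; last by rewrite /vvec pyx.
rewrite uE dotv_hadv [RHS]dotv_hadv; congr dotv.
exact: hadvC.
Qed.

(** Existence suffices, since [argmin] picks a minimizer if there is one. The dual objective is
    minimized with all other coordinates frozen at [x]; there it differs from the subproblem by a
    constant. *)
Lemma lam_argminP x f t : is_minimizer setT (lam_obj x f t)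
  (lam_argmin eps gamma G r theta c x f t).
Proof.
apply: xgetPex.
pose free (j : @coord N F T d) := if j is inl (f', t', _)
  then (f' == f) && (t' == t) else false.
pose C : set {ptws @coord N F T d -> R} :=
  [set z | forall j, ~~ free j -> z j = flat x j].
have cC : closed C.
  rewrite (_ : C = \bigcap_(j in [set j | ~~ free j]) [set z | z j = flat x j]);
    last by apply/seteqP; split=> z.
  by apply: closed_bigI => j _; exact: closed_coord_eq.
have [B HB] := expquad_sublevel_bounded (exp_coef eps G)
  (exp_weight_gt0 eps_gt0 theta c) (quad_coef_ge0 gamma_gt0)
  (lin_coef_eq0 gamma_gt0 r) (phi (flat x)).
have [|||z [Cz zmin]] := @bounded_sublevel_min R _ C phi (flat x)
    (Num.max B (\sum_j `|flat x j|)) cC.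
- exact: expquad_continuous.
- by [].
- move=> z Cz zx j; rewrite le_max.
  have [fj|fj] := boolP (free j).
    rewrite HB//; case: j fj => // -[[f' t'] l] _.
    by rewrite /= invr_gt0.
  by rewrite Cz// orbC (@le_sum_nneg _ _ (fun j => `|flat x j|)).
pose upd l := DualVar (fun f' s => if (f' == f) && (s == t) then l else lam x f' s)
  (psi x).
have updC l : C (flat (upd l)).
  by case=> [[[f' t'] l']|[[t' n] f']] //= /negbTE ->.
have [l0 zE] : exists l0, z = flat (upd l0).
  exists (\col_l z (inl (f, t, l))); apply/funext => j.
  have [fj|fj] := boolP (free j); last by rewrite Cz// updC.
  case: j fj => // -[[f' t'] l] /= /[dup] ft /andP[/eqP -> /eqP ->].
  by rewrite !eqxx mxE.
have updE l : phi (flat (upd l)) = lam_obj x f t l +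
    (\sum_(f' | f' != f) lam_obj x f' t (lam x f' t)
     + \sum_(s | s != t) \sum_f lam_cost f s (lam x f s)).
  rewrite expquad_flat (@dual_objective_lam_block x _ t)//=; last first.
    by move=> f' s /negbTE ->; rewrite andbF.
  rewrite (bigD1 f)//= !eqxx /= -addrA; congr (_ + (_ + _)).
  by apply: eq_bigr => f' /negbTE ->.
exists l0; split=> // l _.
by have := zmin _ (updC l); rewrite zE !updE lerD2r.
Qed.

Lemma psi_argminP x t : is_minimizer [set P : 'M[R]_(N, F) | norm_1inf P <= eta]
  (psi_obj x t) (psi_argmin eps eta G theta c x t).
Proof.
apply: xgetPex.
pose free (j : @coord N F T d) := if j is inr (t', _, _) then t' == t else false.
pose C1 : set {ptws @coord N F T d -> R} :=
  [set z | forall j, ~~ free j -> z j = flat x j].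
(* Only mode [t] is constrained, because [x] may violate the constraints at other modes. For the
   same reason the reference point below has block [0] at [t] instead of that of [x]. *)
pose C2 : set {ptws @coord N F T d -> R} :=
  [set z | forall p : 'I_N * {ffun 'I_F -> bool},
    lin (constr_coef (t, p.1, p.2)) z <= eta].
have cC : closed (C1 `&` C2).
  apply: closedI.
    rewrite (_ : C1 = \bigcap_(j in [set j | ~~ free j]) [set z | z j = flat x j]);
      last by apply/seteqP; split=> z.
    by apply: closed_bigI => j _; exact: closed_coord_eq.
  rewrite (_ : C2 = \bigcap_(p in setT)
    [set z | lin (@constr_coef R N F T d (t, p.1, p.2)) z <= eta]);
      last by apply/seteqP; split=> z h; [move=> p _|move=> p]; apply: h.
  by apply: closed_bigI => p _; exact: closed_halfspace.
have C2E z : C2 z <-> forall n, \sum_f `|z (inr (t, n, f))| <= eta.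
  split=> [H n|H [n s]].
    by apply/signed_sums_le => s; rewrite -lin_constr_coef; exact: (H (n, s)).
  by rewrite lin_constr_coef /=; have /signed_sums_le := H n; apply.
pose upd P := DualVar (lam x) (fun s => if s == t then P else psi x s).
have updC P : norm_1inf P <= eta -> (C1 `&` C2) (flat (upd P)).
  move=> nP; split; first by case=> [[[f' t'] l']|[[t' n] f']] //= /negbTE ->.
  by apply/C2E => n /=; rewrite eqxx; move: n; apply/(norm_1inf_le _ (ltW eta_gt0)).
have [|||z [Cz zmin]] := @bounded_sublevel_min R _ (C1 `&` C2) phi (flat (upd 0))
    (Num.max eta (\sum_j `|flat x j|)) cC.
- exact: expquad_continuous.
- apply/updC/(norm_1inf_le _ (ltW eta_gt0)) => n.
  by rewrite big1 ?(ltW eta_gt0)// => f _; rewrite mxE normr0.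
- move=> z [C1z /C2E C2z] _ j; rewrite le_max.
  have [fj|fj] := boolP (free j).
    case: j fj => // -[[t' n] f] /= /eqP ->.
    by rewrite psi_bound.
  by rewrite C1z// orbC (@le_sum_nneg _ _ (fun j => `|flat x j|)).
have [C1z /C2E C2z] := Cz.
pose P0 : 'M[R]_(N, F) := \matrix_(n, f) z (inr (t, n, f)).
have P0eta : norm_1inf P0 <= eta.
  apply/(norm_1inf_le _ (ltW eta_gt0)) => n.
  by under eq_bigr do rewrite mxE; exact: C2z.
have zE : z = flat (upd P0).
  apply/funext => j.
  have [fj|fj] := boolP (free j); last by rewrite C1z// (updC _ P0eta).1.
  by case: j fj => // -[[t' n] f] /= /eqP ->; rewrite eqxx mxE.
have updE P : phi (flat (upd P)) =
    psi_obj x t P + \sum_s \sum_f lam_cost f s (lam x f s).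
  rewrite expquad_flat (@dual_objective_psi_block x _ t)//= ?eqxx//.
  by move=> s /negbTE ->.
exists P0; split=> // P HP.
by have := zmin _ (updC P HP); rewrite zE !updE lerD2r.
Qed.

Local Notation step1 := (lam_step eps gamma G r theta c).
Local Notation step2 := (psi_step eps eta G theta c).

Lemma lam_step_min x t : dual_feasible eta x ->
  is_minimizer (block_slice constr_coef (fun=> eta) (@block N F T d)
    (lshift T t) (flat x)) phi (flat (step1 x t)).
Proof.
move=> Px; split.
  split; first exact/polyhedron_flat.
  case=> [[[f s] l]|[[s n] f]] //=.
  by rewrite (inj_eq (@lshift_inj _ _)) => /negbTE ->.
move=> z [_ zx]; rewrite -(unflatK z) !expquad_flat.
rewrite !(@dual_objective_lam_block x _ t)//=.
- rewrite lerD2r; apply: ler_sum => f _; rewrite eqxx.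
  by have [_] := lam_argminP x f t; apply.
- apply/funext => s; apply/matrixP => n f; rewrite mxE zx//.
  by rewrite /= eq_rlshift.
- move=> f s st; apply/matrixP => l i.
  by rewrite mxE (ord1 i) zx//= (inj_eq (@lshift_inj _ _)).
- by move=> f s /negbTE ->.
Qed.

Lemma psi_step_feasible x t s : s = t \/ norm_1inf (psi x s) <= eta ->
  norm_1inf (psi (step2 x t) s) <= eta.
Proof.
move=> h; have [Pt _] := psi_argminP x t.
by rewrite /=; case: eqVneq h => [_ _|st [/eqP|]//]; rewrite ?(negbTE st).
Qed.

Lemma psi_step_min x t : dual_feasible eta x ->
  is_minimizer (block_slice constr_coef (fun=> eta) (@block N F T d)
    (rshift T t) (flat x)) phi (flat (step2 x t)).
Proof.
move=> Px; split.
  split; first by apply/polyhedron_flat => // s; apply: psi_step_feasible; right.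
  case=> [[[f s] l]|[[s n] f]] //=.
  by rewrite (inj_eq (@rshift_inj _ _)) => /negbTE ->.
move=> z [Pz zx]; rewrite -(unflatK z) !expquad_flat.
rewrite !(@dual_objective_psi_block x _ t)//=.
- rewrite lerD2r eqxx.
  have [_] := psi_argminP x t; apply.
  have := Pz; rewrite -{1}(unflatK z) => /(polyhedron_flat eta_gt0) h.
  exact: h.
- apply/funext => f; apply/funext => s; apply/matrixP => l i.
  by rewrite mxE (ord1 i) zx//= eq_lrshift.
- move=> s st; apply/matrixP => n f; rewrite mxE zx//=.
  by rewrite (inj_eq (@rshift_inj _ _)).
- by move=> s /negbTE ->.
Qed.

End BlockUpdates.

Lemma enum_ord_cat m n : enum 'I_(m + n) =
  map (@lshift m n) (enum 'I_m) ++ map (@rshift m n) (enum 'I_n).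
Proof.
apply: (@inj_map _ _ (val : 'I_(m + n) -> nat)); first exact: val_inj.
rewrite val_enum_ord map_cat -(map_comp _ (@lshift m n)) -(map_comp _ (@rshift m n)).
rewrite iotaD add0n; congr (_ ++ _).
  by rewrite -val_enum_ord; exact: eq_map.
by rewrite -[in LHS](addn0 m) iotaDl -val_enum_ord -map_comp; exact: eq_map.
Qed.

(** * A sweep as a cycle of block minimizations, and convergence *)

Section Iteration.
Context {R : realType} {N F T d : nat} {Theta : Type}.
Variables (eps gamma eta : R).
Hypotheses (eps_gt0 : 0 < eps) (gamma_gt0 : 0 < gamma) (eta_gt0 : 0 < eta).
Variables (G : 'I_F -> 'M[R]_(d, N)) (r : 'I_F -> 'I_T -> 'cV[R]_d).
Variables (theta : 'I_N -> Theta) (c : Theta -> Theta -> R).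
Implicit Types (x y : dual_var R N F T d).

Local Notation phi := (expquad (exp_weight eps theta c) (exp_coef eps G)
  (@quad_coef R N F T d gamma) (lin_coef r)).
Local Notation feas := (polyhedron (@constr_coef R N F T d) (fun=> eta)).
Local Notation dual := (dual_objective eps gamma G r theta c).
Local Notation iteration := (bcd_iteration eps gamma eta G r theta c).

Definition block_step x (s : 'I_(T + T)) : dual_var R N F T d :=
  match fintype.split s with
  | inl t => lam_step eps gamma G r theta c x t
  | inr t => psi_step eps eta G theta c x t
  end.

Lemma bcd_iterationE x : iteration x = foldl block_step x (enum 'I_(T + T)).
Proof.
rewrite enum_ord_cat foldl_cat.
have foldl_map A B C (f : A -> B -> A) (g : C -> B) s z :
    foldl f z (map g s) = foldl (fun u v => f u (g v)) z s.
  by elim: s z => //=.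
rewrite (foldl_map _ _ _ _ (@lshift T T)) (foldl_map _ _ _ _ (@rshift T T)).
rewrite /bcd_iteration.
have E1 y s : foldl (fun u v => block_step u (lshift T v)) y s =
    foldl (lam_step eps gamma G r theta c) y s.
  by elim: s y => //= t s IH y; rewrite IH /block_step (unsplitK (inl _ _)).
have E2 y s : foldl (fun u v => block_step u (rshift T v)) y s =
    foldl (psi_step eps eta G theta c) y s.
  by elim: s y => //= t s IH y; rewrite IH /block_step (unsplitK (inr _ _)).
by rewrite E1 E2.
Qed.

Lemma block_step_min x s : dual_feasible eta x ->
  is_minimizer (block_slice constr_coef (fun=> eta) (@block N F T d) s (flat x))
    phi (flat (block_step x s)).
Proof.
rewrite /block_step => Px; case: (split_ordP s) => t ->.
  exact: lam_step_min.
exact: psi_step_min.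
Qed.

Lemma foldl_block_step_feasible s x : dual_feasible eta x ->
  dual_feasible eta (foldl block_step x s).
Proof.
elim: s x => //= t s IH x Px; apply: IH.
by have [[/(polyhedron_flat eta_gt0)]] := block_step_min t Px.
Qed.

Lemma bcd_iteration_cycle x : dual_feasible eta x ->
  bcd_cycle (exp_weight eps theta c) (exp_coef eps G) (@quad_coef R N F T d gamma)
    (lin_coef r) constr_coef (fun=> eta) (@block N F T d)
    (flat x) (flat (iteration x)).
Proof.
move=> Px.
exists (fun k => flat (foldl block_step x (take k (enum 'I_(T + T))))).
rewrite take0; split=> //.
  by rewrite take_oversize ?size_enum_ord// bcd_iterationE.
move=> s; rewrite (take_nth s) ?size_enum_ord// nth_ord_enum foldl_rcons.
exact/block_step_min/foldl_block_step_feasible.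
Qed.

Lemma bcd_iteration_feasible x : dual_feasible eta (iteration x).
Proof.
move=> t; rewrite /bcd_iteration; set y := foldl _ x _.
(* Invariant of the [psi] pass: mode [t] is still to be visited or already feasible. *)
have : t \in enum 'I_T \/ norm_1inf (psi y t) <= eta by left; rewrite mem_enum.
elim: (enum 'I_T) y => [y [|]//|s l IH y h] /=.
apply: IH; case: h => [|h]; last by right; apply: psi_step_feasible; auto.
rewrite inE => /orP[/eqP ->|]; last by left.
by right; apply: psi_step_feasible; auto.
Qed.

Lemma dual_feasible0 : dual_feasible eta (DualVar (fun _ _ => 0) (fun _ => 0)
  : dual_var R N F T d).
Proof.
move=> t /=; apply/(norm_1inf_le _ (ltW eta_gt0)) => n.
by rewrite big1 ?(ltW eta_gt0)// => f _; rewrite mxE normr0.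
Qed.

Lemma polyhedron_closed (J I : finType) (a : I -> J -> R) (b : I -> R) :
  closed (polyhedron a b : set {ptws J -> R}).
Proof.
rewrite (_ : polyhedron a b = \bigcap_(i in setT) [set z | lin (a i) z <= b i]);
  last by apply/seteqP; split=> z h; [move=> p _|move=> p]; apply: h.
by apply: closed_bigI => p _; exact: closed_halfspace.
Qed.

Lemma dual_min_exists : exists z, is_minimizer feas phi z.
Proof.
have [B HB] := feasible_sublevel_bounded eta eps_gt0 gamma_gt0 G r theta c
  (phi (flat (DualVar (fun _ _ => 0) (fun _ => 0)))).
apply: (bounded_sublevel_min _ _ _ HB).
- exact: polyhedron_closed.
- exact: expquad_continuous.
- by apply/(polyhedron_flat eta_gt0); exact: dual_feasible0.
Qed.

Lemma dual_dist_le x y (C : R) : 0 <= C ->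
  (forall j, `|flat x j - flat y j| <= C) ->
  dual_dist x y <= Num.sqrt ((T * F * (d + N))%:R) * C.
Proof.
move=> C0 H.
have sq u : `|u| <= C -> u ^+ 2 <= C ^+ 2.
  by move=> uC; rewrite -(real_normK (num_real u)) ler_pXn2r ?nnegrE.
rewrite /dual_dist -[X in _ * X](ger0_norm C0) -sqrtr_sqr -sqrtrM//.
rewrite ler_wsqrtr// mulr_natl.
apply: (@le_trans _ _ (\sum_(t < T) \sum_(f < F) C ^+ 2 *+ (d + N))).
  apply: ler_sum => t _; apply: ler_sum => f _; rewrite mulrnDr lerD//.
    rewrite -[d in leRHS]card_ord -sumr_const; apply: ler_sum => l _.
    by rewrite !mxE; apply/sq/(H (inl (f, t, l))).
  rewrite -[N in leRHS]card_ord -sumr_const; apply: ler_sum => n _.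
  by rewrite !mxE; apply/sq/(H (inr (t, n, f))).
rewrite !sumr_const !card_ord -!mulrnA.
by rewrite mulnC (mulnC F).
Qed.

Theorem bcd_converges_linearly x0 : exists xstar,
  is_minimizer (dual_feasible eta) dual xstar /\
  converges_linearly (fun k => iter k iteration x0) xstar.
Proof.
have [zs zsmin] := dual_min_exists.
have Px1 := bcd_iteration_feasible x0.
have [B HB] := feasible_sublevel_bounded eta eps_gt0 gamma_gt0 G r theta c
  (phi (flat (iteration x0))).
have Pk k : dual_feasible eta (iter k.+1 iteration x0).
  by case: k => [|k] //; exact: bcd_iteration_feasible.
(* The sequence starts at the first iterate, which is feasible even when [x0] is not. *)
have [||xs [C [rho [xsmin /andP[r0 r1] xsC]]]] := bcd_linear_convergence
  (exp_weight_gt0 eps_gt0 theta c) (quad_coef_ge0 gamma_gt0)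
  (lin_coef_eq0 gamma_gt0 r) (block_separation eps_gt0 gamma_gt0 G)
  (@polyhedron_product R N F T d eta) zsmin _ HB
  (x := fun k => flat (iter k.+1 iteration x0)) erefl.
- exact/(polyhedron_flat eta_gt0).
- by move=> k; apply: bcd_iteration_cycle.
exists (unflat xs); split.
  split; first by apply/(polyhedron_flat eta_gt0); rewrite unflatK; case: xsmin.
  move=> y Py; rewrite -!expquad_flat unflatK; apply: xsmin.2.
  exact/(polyhedron_flat eta_gt0).
pose D := \sum_j `|flat x0 j - xs j|.
have D0 : 0 <= D by exact: sumr_ge0.
(* Undoing the index shift divides by the rate, and [rho] may be [0]; [rho'] is positive and still
   below [1]. The summand [D] covers the iterate [x0]. *)
pose rho' := (1 + rho) / 2; pose C' := D + `|C| / rho'.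
have r'0 : 0 < rho' by rewrite divr_gt0//; lra.
have C'0 : 0 <= C' by rewrite addr_ge0// divr_ge0// ltW.
exists (Num.sqrt ((T * F * (d + N))%:R) * C'), rho'; split.
  by rewrite ltW//= /rho'; lra.
move=> k; rewrite -mulrA; apply: dual_dist_le.
  by rewrite mulr_ge0// exprn_ge0// ltW.
move=> j; rewrite unflatK; case: k => [|k].
  rewrite expr0 mulr1; apply: (@le_trans _ _ D).
    exact: (@le_sum_nneg _ _ (fun j => `|flat x0 j - xs j|)).
  by rewrite lerDl divr_ge0// ltW.
apply: (le_trans (xsC k j)); apply: (@le_trans _ _ (`|C| * rho' ^+ k)).
  apply: (@le_trans _ _ (`|C| * rho ^+ k)).
    by rewrite ler_wpM2r ?exprn_ge0 ?ler_norm.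
  by rewrite ler_wpM2l// lerXn2r ?nnegrE ?(ltW r'0)// /rho'; lra.
rewrite exprS mulrA ler_wpM2r ?exprn_ge0 ?(ltW r'0)//.
by rewrite mulrDl divfK ?gt_eqF// lerDr mulr_ge0// ltW.
Qed.

End Iteration.

(** * The primal problem *)

(* [ln 0 = 0] makes this [p] at [m = 0], the limiting value. *)
Definition kl (R : realType) (m p : R) : R := m * ln m - m - m * ln p + p.

Lemma kl_expR (R : realType) (m p : R) : 0 < m -> 0 < p ->
  kl m p = m * (expR (ln p - ln m) - 1 - (ln p - ln m)).
Proof.
move=> m0 p0; rewrite expRD expRN !lnK ?posrE// /kl; field; rewrite gt_eqF//.
Qed.

Lemma kl_ge0 (R : realType) (m p : R) : 0 <= m -> 0 < p -> 0 <= kl m p.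
Proof.
rewrite le_eqVlt => /orP[/eqP <-|m0] p0; first by rewrite /kl !mul0r; lra.
rewrite kl_expR// mulr_ge0 ?(ltW m0)//.
by have := expR_ge1Dx (ln p - ln m); lra.
Qed.

(** At [m = 0] the divergence is [p > 0]. Otherwise the quadratic lower bound on the exponential
    forces [ln p = ln m]. *)
Lemma kl_eq0 (R : realType) (m p : R) : 0 <= m -> 0 < p -> kl m p <= 0 -> m = p.
Proof.
rewrite le_eqVlt => /orP[/eqP <-|m0] p0; first by rewrite /kl !mul0r; lra.
rewrite kl_expR// pmulr_rle0//; set h := ln p - ln m => h0.
have hq : h ^+ 2 / (4 * (1 + `|h|)) <= expR h - 1 - h.
  by apply: expR_quadratic_ge; have := normr_ge0 h; lra.
have : h ^+ 2 <= 0.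
  have hp : 0 < 4 * (1 + `|h|) by have := normr_ge0 h; lra.
  by have := le_trans hq h0; rewrite ler_pdivrMr// mul0r.
rewrite exprn_even_le0//= /h subr_eq0 => /eqP E.
by apply: ln_inj; rewrite ?posrE.
Qed.

(** Put all the mass [eta] on one index of maximal [|p f|], with the opposite sign. If the maximum
    is its default [0], take [v = 0]. *)
Lemma norm_inf1_attained (R : realType) (F : nat) (p : 'I_F -> R) (eta : R) :
  0 <= eta -> exists2 v : 'I_F -> R, \sum_f `|v f| <= eta &
    \sum_f p f * v f = - eta * \big[Num.max/0]_f `|p f|.
Proof.
move=> eta0.
have [->|[f0 ->]] : \big[Num.max/0]_f `|p f| = 0 \/
    exists f0, \big[Num.max/0]_f `|p f| = `|p f0|.
- elim/big_rec: _ => [|f y _ [->|[f0 ->]]]; first by left.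
    by right; exists f; apply/max_idPl.
  by right; case: (leP `|p f| `|p f0|) => _; [exists f0|exists f].
- exists (fun=> 0); first by rewrite big1// => f _; rewrite normr0.
  by rewrite mulr0 big1// => f _; rewrite mulr0.
exists (fun f => (f == f0)%:R * (- eta * Num.sg (p f0))).
  rewrite (bigD1 f0)//= eqxx mul1r [X in _ + X]big1 ?addr0; last first.
    by move=> f /negbTE ->; rewrite mul0r normr0.
  rewrite normrM normrN (ger0_norm eta0) normr_sg.
  by case: (p f0 != 0); rewrite ?mulr1 ?mulr0.
under eq_bigr do rewrite mulrCA.
by rewrite (sum_pick f0 (fun f => p f * (- eta * Num.sg (p f0)))) normrEsg; ring.
Qed.

Lemma dot_norm_inf1 (R : realType) (F : nat) (p v : 'I_F -> R) (eta : R) :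
  \sum_f `|v f| <= eta ->
  0 <= eta * \big[Num.max/0]_f `|p f| + \sum_f p f * v f.
Proof.
move=> veta; set B := \big[_/_]_(_ | _) _.
have B0 : 0 <= B by apply: bigmax_ge_id.
rewrite -lerBlDr sub0r -sumrN (@le_trans _ _ (\sum_f B * `|v f|))//; last first.
  by rewrite -mulr_sumr mulrC ler_wpM2r.
apply: ler_sum => f _; rewrite (le_trans (ler_norm _))// normrN normrM.
by rewrite ler_wpM2r// /B; apply: (le_bigmax_cond _ (fun f => `|p f|)).
Qed.

Lemma sum_proj (R : realType) N T (M : tensor R N T) (t : 'I_T) (g : 'I_N -> R) :
  \sum_i M i * g (i t) = \sum_n Defs.proj t M n 0 * g n.
Proof.
rewrite (partition_big (fun i : {ffun 'I_T -> 'I_N} => i t) predT)//=.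
apply: eq_bigr => n _; rewrite mxE mulr_suml; apply: eq_bigr => i /eqP <- //.
Qed.

(** * The duality gap and first-order optimality *)

Section PrimalDual.
Context {R : realType} {N F T d : nat} {Theta : Type}.
Variables (eps gamma eta : R).
Hypotheses (eps_gt0 : 0 < eps) (gamma_gt0 : 0 < gamma) (eta_gt0 : 0 < eta).
Variables (G : 'I_F -> 'M[R]_(d, N)) (r : 'I_F -> 'I_T -> 'cV[R]_d).
Variables (theta : 'I_N -> Theta) (c : Theta -> Theta -> R).
Implicit Types (x y : dual_var R N F T d) (M : 'I_F -> tensor R N T).

Local Notation phi := (expquad (exp_weight eps theta c) (exp_coef eps G)
  (@quad_coef R N F T d gamma) (lin_coef r)).
Local Notation feas := (polyhedron (@constr_coef R N F T d) (fun=> eta)).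
Local Notation dual := (dual_objective eps gamma G r theta c).
Local Notation primal := (primal_objective eps gamma eta G r theta c).
Local Notation Mx x := (primal_of_dual eps G theta c x).

Lemma primal_of_dualE x f i : Mx x f i =
  expR (lin (exp_coef eps G (f, i)) (flat x) - cost_tensor theta c T i / eps).
Proof.
rewrite expRD expR_lin_exp_coef /primal_of_dual !hadtE mulrAC; congr (_ * _).
by rewrite ffunE mulNr.
Qed.

Lemma primal_of_dual_gt0 x f i : 0 < Mx x f i.
Proof. by rewrite primal_of_dualE expR_gt0. Qed.

Lemma exp_weight_primal x f i :
  exp_weight eps theta c (f, i) * expR (lin (exp_coef eps G (f, i)) (flat x))
  = eps * Mx x f i.
Proof. by rewrite expR_lin_exp_coef /primal_of_dual !hadtE /exp_weight /=; ring. Qed.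

Definition kl_gap x M : R := \sum_f \sum_i kl (M f i) (Mx x f i).

Definition data_gap x M : R := \sum_t \sum_f
  (2 * gamma)^-1 * normsq (gamma *: (r f t - G f *m Defs.proj t (M f)) - lam x f t).

Definition norm_gap x M : R := \sum_t \sum_n
  (eta * \big[Num.max/0]_f `|Defs.proj t (M f) n 0|
   + \sum_f Defs.proj t (M f) n 0 * psi x t n f).

(** Since [eps * ln] of an entry of [U_f K V_f] is its exponent times [eps] minus the cost, the cost
    is absorbed into the divergence. What remains is linear in [M f] and depends on its marginals
    only. The constant comes from the [+ 1] in [entropy]. *)
Lemma entropic_cost_gap x M f :
  dott (cost_tensor theta c T) (M f) + eps * entropy (M f) =
  \sum_(i : {ffun 'I_T -> 'I_N}) eps - eps * \sum_i Mx x f i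
  + eps * \sum_i kl (M f i) (Mx x f i)
  + (\sum_t dotv (lam x f t) (G f *m Defs.proj t (M f))
     + \sum_t \sum_n Defs.proj t (M f) n 0 * psi x t n f).
Proof.
have -> : \sum_t dotv (lam x f t) (G f *m Defs.proj t (M f))
     + \sum_t \sum_n Defs.proj t (M f) n 0 * psi x t n f =
    \sum_i M f i * (eps * lin (exp_coef eps G (f, i)) (flat x)).
  under [RHS]eq_bigr do rewrite lin_exp_coef mulr_sumr mulr_sumr.
  rewrite [RHS]exchange_big -big_split; apply: eq_bigr => t _ /=.
  rewrite dotv_mulmx dotvC /dotv -big_split /=.
  under eq_bigr do rewrite -mulrDr.
  rewrite -(sum_proj (M f) t (fun n => ((G f)^T *m lam x f t) n 0 + psi x t n f)).
  by apply: eq_bigr => i _; congr (_ * _); field; rewrite gt_eqF//.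
rewrite /dott /entropy !mulr_sumr -sumrB -!big_split; apply: eq_bigr => i _ /=.
rewrite /kl {2}primal_of_dualE expRK; field; rewrite gt_eqF//.
Qed.

(** Fenchel-Young for the squared norm, with its defect written as a completed square. *)
Lemma quadratic_gap (g : R) n (l p s : 'cV[R]_n) : 0 < g ->
  g / 2 * normsq (p - s) = (2 * g)^-1 * normsq (g *: (p - s) - l)
    + dotv l p - dotv l s - (2 * g)^-1 * normsq l.
Proof.
move=> g0; rewrite /normsq /dotv !mulr_sumr -big_split -!sumrB /=.
by apply: eq_bigr => i _; rewrite !mxE; field; rewrite gt_eqF//.
Qed.

(** The pairings [X] and [Y] of [lam] and [psi] with the marginals cancel between the entropic part,
    the data term and the norm term. *)
Lemma primal_dual_gap x M : primal M =
  \sum_(f < F) \sum_(i : {ffun 'I_T -> 'I_N}) eps - dual x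
  + (eps * kl_gap x M + data_gap x M + norm_gap x M).
Proof.
pose X := \sum_t \sum_f dotv (lam x f t) (G f *m Defs.proj t (M f)).
pose Y := \sum_t \sum_f \sum_n Defs.proj t (M f) n 0 * psi x t n f.
pose L := \sum_t \sum_f dotv (lam x f t) (r f t).
pose Q := \sum_t \sum_f (2 * gamma)^-1 * normsq (lam x f t).
pose P := eps * \sum_f \sum_i Mx x f i.
pose B := \sum_t \sum_n \big[Num.max/0]_f `|Defs.proj t (M f) n 0|.
have dualE : dual x = P + (Q - L).
  rewrite /dual_objective /P /Q /L -sumrB; congr (_ + _); last first.
    by apply: eq_bigr => t _; rewrite -sumrB.
  rewrite mulr_sumr; apply: eq_bigr => f _; congr (_ * _).
  by apply: eq_bigr => i _; rewrite /primal_of_dual !hadtE; ring.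
have normE : norm_gap x M = eta * B + Y.
  rewrite /norm_gap /B /Y mulr_sumr -big_split; apply: eq_bigr => t _ /=.
  by rewrite big_split /= -mulr_sumr [X in _ + X = _]exchange_big.
rewrite dualE normE /primal_objective.
have -> : \sum_f (dott (cost_tensor theta c T) (M f) + eps * entropy (M f)) =
    \sum_(f < F) \sum_(i : {ffun 'I_T -> 'I_N}) eps - P + eps * kl_gap x M + (X + Y).
  rewrite /P /kl_gap /X /Y !mulr_sumr.
  rewrite [X in _ + (X + _)]exchange_big [X in _ + (_ + X)]exchange_big /=.
  rewrite -sumrB -!big_split; apply: eq_bigr => f _ /=.
  exact: entropic_cost_gap.
have -> : \sum_t \sum_f gamma / 2 * normsq (r f t - G f *m Defs.proj t (M f)) =
    data_gap x M + L - X - Q.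
  rewrite /data_gap /L /X /Q -big_split -!sumrB; apply: eq_bigr => t _ /=.
  rewrite -big_split -!sumrB; apply: eq_bigr => f _ /=.
  exact: quadratic_gap.
have -> : \sum_t norm_inf1 (\matrix_(i, f) Defs.proj t (M f) i 0) = B.
  apply: eq_bigr => t _; apply: eq_bigr => n _.
  by apply: eq_bigr => f _; rewrite mxE.
ring.
Qed.

Lemma kl_gap_ge0 x M : primal_feasible M -> 0 <= kl_gap x M.
Proof.
move=> M0; apply: sumr_ge0 => f _; apply: sumr_ge0 => i _.
exact: kl_ge0 (M0 f i) (primal_of_dual_gt0 x f i).
Qed.

Lemma kl_gap_eq0 x M : primal_feasible M -> kl_gap x M <= 0 -> M = Mx x.
Proof.
move=> M0 K0; apply/funext => f; apply/ffunP => i.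
have k0 f' i' := kl_ge0 (M0 f' i') (primal_of_dual_gt0 x f' i').
apply: (kl_eq0 (M0 f i) (primal_of_dual_gt0 x f i)); apply: le_trans K0.
apply: (@le_trans _ _ (\sum_i kl (M f i) (Mx x f i))).
  exact: (@le_sum_nneg _ _ (fun i => kl (M f i) (Mx x f i))).
apply: (@le_sum_nneg _ _ (fun f => \sum_i kl (M f i) (Mx x f i))) => f'.
by apply: sumr_ge0 => i' _; exact: k0.
Qed.

Lemma data_gap_ge0 x M : 0 <= data_gap x M.
Proof.
apply: sumr_ge0 => t _; apply: sumr_ge0 => f _; rewrite mulr_ge0//.
  by rewrite invr_ge0 mulr_ge0// ltW.
by apply: sumr_ge0 => l _; exact: sqr_ge0.
Qed.

Lemma norm_gap_ge0 x M : dual_feasible eta x -> 0 <= norm_gap x M.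
Proof.
move=> Px; apply: sumr_ge0 => t _; apply: sumr_ge0 => n _.
apply: dot_norm_inf1.
by have /(norm_1inf_le _ (ltW eta_gt0)) := Px t; apply.
Qed.

Local Notation grad := (expquad_grad (exp_weight eps theta c) (exp_coef eps G)
  (@quad_coef R N F T d gamma) (lin_coef r)).

(** Each weighted exponential is [eps] times an entry of [U_f K V_f], so its partial derivatives add
    up to marginals of that tensor. *)
Lemma expquad_grad_flat x j : grad (flat x) j = match j with
  | inl (f, t, l) => (G f *m Defs.proj t (Mx x f)) l 0
                     + (gamma^-1 * lam x f t l 0 - r f t l 0)
  | inr (t, n, f) => Defs.proj t (Mx x f) n 0 end.
Proof.
have sumK (h : expterm -> R) : \sum_k h k = \sum_f \sum_i h (f, i).
  by rewrite pair_bigA; apply: eq_bigr => -[].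
rewrite /expquad_grad sumK.
under eq_bigr do under eq_bigr do rewrite exp_weight_primal.
case: j => [[[f t] l]|[[t n] f]] /=.
  congr (_ + _).
  under eq_bigr => f' _ do
    (under eq_bigr => i _ do rewrite eq_sym mulrCA; rewrite -mulr_sumr).
  rewrite (sum_pick f (fun f' => \sum_i eps * Mx x f' i * (eps^-1 * G f l (i t)))).
  rewrite mxE; under [RHS]eq_bigr do rewrite mulrC.
  rewrite -sum_proj; apply: eq_bigr => i _; field; rewrite gt_eqF//.
rewrite mul0r subrr addr0.
under eq_bigr => f' _ do
  (under eq_bigr => i _ do rewrite eq_sym mulrCA; rewrite -mulr_sumr).
rewrite (sum_pick f (fun f' => \sum_i eps * Mx x f' i * ((n == i t)%:R * eps^-1))).
rewrite mxE [RHS]big_mkcond; apply: eq_bigr => i _.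
rewrite eq_sym; case: eqP => _; last by rewrite mul0r mulr0.
by rewrite /= mul1r mulrAC divff ?mul1r// gt_eqF.
Qed.

Section AtMinimizer.
Variable xs : dual_var R N F T d.
Hypothesis xs_min : is_minimizer (dual_feasible eta) dual xs.

Let flat_min : is_minimizer feas phi (flat xs).
Proof.
case: xs_min => Px xmin; split; first exact/(polyhedron_flat eta_gt0).
move=> z Pz; rewrite -(unflatK z) !expquad_flat; apply: xmin.
by apply/(polyhedron_flat eta_gt0); rewrite unflatK.
Qed.

Let variational z : feas z ->
  0 <= \sum_j grad (flat xs) j * (z j - flat xs j).
Proof.
exact: (expquad_variational (exp_weight_gt0 eps_gt0 theta c)
  (quad_coef_ge0 gamma_gt0) (@polyhedron_convex _ _ _ _ _) flat_min).
Qed.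

Lemma minimizer_lam f t :
  lam xs f t = gamma *: (r f t - G f *m Defs.proj t (Mx xs f)).
Proof.
apply/matrixP => l i; rewrite (ord1 i).
suff g0 : grad (flat xs) (inl (f, t, l)) = 0.
  move: g0; rewrite expquad_grad_flat; set p := G f *m _ => g0.
  have E : gamma^-1 * lam xs f t l 0 = r f t l 0 - p l 0 by lra.
  by rewrite 3!mxE -E mulVKf// gt_eqF.
(* The [lam] coordinates are unconstrained, so both signs of [e] are admissible and the partial
   derivative vanishes. *)
have push (e : R) : 0 <= grad (flat xs) (inl (f, t, l)) * e.
  pose z j := flat xs j + (j == inl (f, t, l))%:R * e.
  have Pz : feas z.
    apply/polyhedronE => s n; rewrite /z /=.
    under eq_bigr do rewrite mul0r addr0.
    by have /polyhedronE := flat_min.1; apply.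
  have := variational Pz; congr (_ <= _).
  under eq_bigr => j _ do rewrite /z addrAC subrr add0r mulrCA.
  by rewrite (sum_pick _ (fun j => grad (flat xs) j * e)).
apply/le_anti; have := push 1; have := push (-1).
by rewrite mulr1 mulrN1 oppr_ge0 => -> ->.
Qed.

(** The [psi] part of the gradient consists of the marginals. Testing optimality with the extremal
    [v] of [norm_inf1_attained] at every [(t, n)], and [lam] unchanged, gives the bound. *)
Lemma minimizer_norm_gap : norm_gap xs (Mx xs) <= 0.
Proof.
pose p t n f := Defs.proj t (Mx xs f) n 0.
have /choice[v Hv] : forall tn : 'I_T * 'I_N, exists v : 'I_F -> R,
    \sum_f `|v f| <= eta /\
    \sum_f p tn.1 tn.2 f * v f = - eta * \big[Num.max/0]_f `|p tn.1 tn.2 f|.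
  by move=> tn; have [v v1 v2] := norm_inf1_attained (p tn.1 tn.2) (ltW eta_gt0);
    exists v.
pose z (j : coord) := match j with
  | inl (f, t, l) => lam xs f t l 0 | inr (t, n, f) => v (t, n) f end.
have Pz : feas z.
  by apply/polyhedronE => t n; have [] := Hv (t, n).
have := variational Pz; rewrite sum_coord.
rewrite big1 ?add0r; last first.
  move=> f _; rewrite big1// => t _; rewrite big1// => l _.
  by rewrite /= subrr mulr0.
rewrite -oppr_le0 -sumrN; apply: le_trans; apply: ler_sum => t _.
rewrite -sumrN; apply: ler_sum => n _.
under [X in _ <= - X]eq_bigr do rewrite expquad_grad_flat mulrBr.
rewrite sumrB; have [_ /= ->] := Hv (t, n); rewrite mulNr opprB opprK addrC.
exact: lexx.
Qed.

(** All three gaps vanish at [Mx xs], so any feasible [M] costs at least [eps * kl_gap xs M] more.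
    This gives both optimality and uniqueness. *)
Theorem primal_minimizers :
  [set M | is_minimizer (@primal_feasible R N F T) primal M] = [set Mx xs].
Proof.
have gaps : eps * kl_gap xs (Mx xs) + data_gap xs (Mx xs) + norm_gap xs (Mx xs) <= 0.
  rewrite (_ : kl_gap _ _ = 0); last first.
    rewrite /kl_gap big1// => f _; rewrite big1// => i _; rewrite /kl; ring.
  rewrite (_ : data_gap _ _ = 0); last first.
    rewrite /data_gap big1// => t _; rewrite big1// => f _.
    rewrite minimizer_lam subrr /normsq big1 ?mulr0// => l _.
    by rewrite mxE expr0n.
  by rewrite mulr0 !add0r minimizer_norm_gap.
have lower M : primal_feasible M ->
    primal (Mx xs) + eps * kl_gap xs M <= primal M.
  move=> M0; rewrite !(primal_dual_gap xs).
  have := data_gap_ge0 xs M; have := norm_gap_ge0 M xs_min.1.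
  by move: gaps; lra.
have Mx0 : primal_feasible (Mx xs).
  by move=> f i; rewrite ltW// primal_of_dual_gt0.
apply/seteqP; split=> [M [M0 Mmin]|_ ->].
  apply: (kl_gap_eq0 M0); rewrite -(pmulr_rle0 _ eps_gt0).
  by have := lower M M0; have := Mmin _ Mx0; lra.
split=> // M M0; apply: le_trans (lower M M0).
by rewrite lerDl mulr_ge0 ?(ltW eps_gt0)// kl_gap_ge0.
Qed.

End AtMinimizer.
End PrimalDual.

Theorem mainTheorem4 (R : realType) (N F T Q : nat) (eps gamma eta : R)
    (eps_gt0 : 0 < eps) (gamma_gt0 : 0 < gamma) (eta_gt0 : 0 < eta)
    (G : 'I_F -> 'M[R]_(2 * Q ^ 2, N))
    (r : 'I_F -> 'I_T -> 'cV[R]_(2 * Q ^ 2))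
    (Theta : Type) (theta : 'I_N -> Theta) (c : Theta -> Theta -> R)
    (x0 : dual_var R N F T (2 * Q ^ 2)) :
  exists xstar : dual_var R N F T (2 * Q ^ 2),
    [/\ is_minimizer (dual_feasible eta)
          (dual_objective eps gamma G r theta c) xstar,
        converges_linearly
          (fun k => iter k (bcd_iteration eps gamma eta G r theta c) x0) xstar
      & [set M | is_minimizer (@primal_feasible R N F T)
                   (primal_objective eps gamma eta G r theta c) M]
        = [set primal_of_dual eps G theta c xstar]].
Proof.
have [xs [xsmin xscv]] :=
  bcd_converges_linearly eps_gt0 gamma_gt0 eta_gt0 G r theta c x0.
by exists xs; split=> //; exact: primal_minimizers.
Qed.
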